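(* Assume that: (i) for every $\Lambda\subset\{1,\dots,d\}$ and all $x,x'\in\mathbb{Z}^{\Lambda,d}_+$ there is a finite sequence $z_0,\dots,z_k\in\mathbb{Z}^{\Lambda,d}_+$ with $z_0=x$, $z_k=x'$ and $\mu(z_j-z_{j-1})>0$ for all $j=1,\dots,k$; (ii) the function $\varphi(a)=\sum_{z\in\mathbb{Z}^d}\mu(z)\exp(a\cdot z)$ is finite in a neighborhood of the set $D=\{a\in\mathbb{R}^d:\varphi(a)\le 1\}$; (iii) $M=\sum_{x\in\mathbb{Z}^d}\mu(x)\,x\neq 0$. Suppose that the coordinates of $M$ are strictly positive. Then: (1) the function $h(x)=\mathbb{P}_x(\tau=\infty)$ is strictly positive on $\mathbb{Z}^d_+$ and harmonic for the Markov chain $(Z(t))$; (2) any sequence $x_n\in\mathbb{Z}^d_+$ with $\lim_n|x_n|=\infty$ and $\lim_n x_n/|x_n|=M/|M|$ is fundamental for $(Z(t))$, and for any $x\in\mathbb{Z}^d_+$, $$\lim_n\frac{G(x,x_n)}{G(x_0,x_n)}=\frac{\mathbb{P}_x(\tau=\infty)}{\mathbb{P}_{x_0}(\tau=\infty)}.$$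
   Context: $d\ge1$, $\mu$ is a probability measure on $\mathbb{Z}^d$, $|\cdot|$ is the Euclidean norm, $x^i$ is the $i$-th coordinate of $x$. $\mathbb{Z}^d_+=\{x\in\mathbb{Z}^d:x^i>0\ \forall i\}$ and, for $\Lambda\subset\{1,\dots,d\}$, $\mathbb{Z}^{\Lambda,d}_+=\{x\in\mathbb{Z}^d:x^i>0\ \forall i\in\Lambda\}$. $(S(t))_{t\in\mathbb{N}}$ is the random walk on $\mathbb{Z}^d$ with transition probabilities $p(x,x')=\mu(x'-x)$, with $\mathbb{P}_x$ referring to $S(0)=x$; $\tau=\inf\{n\ge0:S^i(n)\le0\text{ for some }i\in\{1,\dots,d\}\}$. $(Z(t))$ is the substochastic Markov chain on $\mathbb{Z}^d_+$ with transition matrix $(\mu(x'-x))_{x,x'\in\mathbb{Z}^d_+}$ ($S(t)$ killed at $\tau$), with Green function $G(x,x')=\sum_{t\ge0}\mathbb{P}_x(S(t)=x',\ \tau>t)$. A function $h$ is harmonic for $(Z(t))$ if $\sum_{x'\in\mathbb{Z}^d_+}\mu(x'-x)h(x')=h(x)$ for all $x\in\mathbb{Z}^d_+$. $x_0\in\mathbb{Z}^d_+$ is a fixed reference point; a sequence $x_n\in\mathbb{Z}^d_+$ with $|x_n|\to\infty$ is fundamental for $(Z(t))$ if $G(x,x_n)/G(x_0,x_n)$ converges for every $x\in\mathbb{Z}^d_+$. *)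

(* Defs.v *)
From HB Require Import structures.
From mathcomp Require Import all_boot all_order all_algebra.
From mathcomp Require Import all_classical all_reals all_analysis.

Set Implicit Arguments.
Unset Strict Implicit.
Unset Printing Implicit Defensive.

Import Order.TTheory GRing.Theory Num.Theory.
Import numFieldNormedType.Exports.

Local Open Scope classical_set_scope.
Local Open Scope ring_scope.

Section Lattice.
Variables (R : realType) (d : nat).

Definition intv (z : 'rV[int]_d) : 'rV[R]_d := map_mx intr z.

(* The norm [`|a|] on ['rV[R]_d] is the sup norm, so the Euclidean norm is
   defined separately. *)
Definition enorm (a : 'rV[R]_d) : R := Num.sqrt (\sum_i (a 0 i) ^+ 2).

Definition dotp (a b : 'rV[R]_d) : R := \sum_i a 0 i * b 0 i.

Definition orthant : set 'rV[int]_d := [set x | forall i, 0 < x 0 i].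

Definition orthant_on (L : {set 'I_d}) : set 'rV[int]_d :=
  [set x | forall i, i \in L -> 0 < x 0 i].

(* Sum of a signed family over a set. [\esum] is only meaningful for
   nonnegative terms, hence the decomposition; [lsum D f] is the unordered sum
   of [f] when [summable D (EFin \o f)]. *)
Definition lsum (D : set 'rV[int]_d) (f : 'rV[int]_d -> R) : R :=
  fine (\esum_(z in D) (Num.max (f z) 0)%:E)
  - fine (\esum_(z in D) (Num.max (- f z) 0)%:E).

(* A probability measure on the countable set Z^d, given by its masses. *)
Definition prob_mass (mu : 'rV[int]_d -> R) : Prop :=
  (forall z, 0 <= mu z) /\ \esum_(z in setT) (mu z)%:E = 1%E.

Variable mu : 'rV[int]_d -> R.

Definition drift : 'rV[R]_d :=
  \row_i lsum setT (fun z => mu z * (intv z) 0 i).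

Definition laplace (a : 'rV[R]_d) : \bar R :=
  \esum_(z in setT) (mu z * expR (dotp a (intv z)))%:E.

Definition sublevel1 : set 'rV[R]_d := [set a | (laplace a <= 1)%E].

Definition communicates (A : set 'rV[int]_d) : Prop :=
  forall x x', A x -> A x' ->
  exists (k : nat) (z : nat -> 'rV[int]_d),
    [/\ z 0%N = x, z k = x',
        forall j, (j <= k)%N -> A (z j) &
        forall j, (1 <= j <= k)%N -> 0 < mu (z j - z j.-1)].

Definition killed_harmonic (h : 'rV[int]_d -> R) : Prop :=
  forall x, orthant x ->
    summable orthant (fun x' => (mu (x' - x) * h x')%:E) /\
    lsum orthant (fun x' => mu (x' - x) * h x') = h x.

Section Walk.
Context {dO : measure_display} {Omega : measurableType dO}.
Variables (P : 'rV[int]_d -> probability Omega R)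
          (S : nat -> Omega -> 'rV[int]_d).

(* Under [P x], [S] is the Markov chain started at [x] with transition
   probabilities [p(y, y') = mu (y' - y)], described by its finite-dimensional
   distributions. *)
Definition random_walk : Prop :=
  (forall t z, measurable [set w | S t w = z]) /\
  (forall x (n : nat) (z : nat -> 'rV[int]_d),
     P x [set w | forall k, (k <= n)%N -> S k w = z k] =
     ((z 0%N == x)%:R * \prod_(0 <= k < n) mu (z k.+1 - z k))%:E).

(* [ereal_inf set0 = +oo]. *)
Definition exit_time (w : Omega) : \bar R :=
  ereal_inf [set n%:R%:E | n in [set n | exists i, S n w 0 i <= 0]].

Definition survival (x : 'rV[int]_d) : R :=
  fine (P x [set w | exit_time w = +oo%E]).

Definition green (x x' : 'rV[int]_d) : \bar R :=
  (\sum_(0 <= t <oo) P x [set w | S t w = x' /\ t%:R%:E < exit_time w])%E.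

Definition fundamental (x0 : 'rV[int]_d) (u : nat -> 'rV[int]_d) : Prop :=
  [/\ forall n, orthant (u n),
      enorm (intv (u n)) @[n --> \oo] --> +oo &
      forall x, orthant x ->
        exists l : R,
          (green x (u n) / green x0 (u n))%E @[n --> \oo] --> l%:E].

End Walk.

End Lattice.

(* Main.v *)
Require Import Defs.
From mathcomp Require Import all_boot all_order all_algebra.
From mathcomp Require Import all_classical all_reals all_analysis.
From mathcomp Require Import finmap zify ring lra.
Import Order.TTheory GRing.Theory Num.Theory.
Import numFieldNormedType.Exports.
Local Open Scope classical_set_scope.
Local Open Scope ring_scope.

Set Implicit Arguments.
Unset Strict Implicit.
Unset Printing Implicit Defensive.

(** Write [g_y(x)] for the Green function of the free walk, [h] for the survival
    probability.  First-exit decomposition on the orthant gives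
    [G(x, y) = g_y(x) - E_x [g_y(S(tau)); tau < oo]], so the theorem reduces to
    showing that [g_y(z) / g_y(0)] tends to [1], in the weighted norm
    [sup_z e^(- eps |z|) |.|], when [y] goes to infinity in the direction of the
    drift: the exit position has an exponential moment, and hence
    [G(x, y) / g_y(0)] tends to [1 - P_x(tau < oo) = h(x)].

    No local limit theorem is needed for this.
    - Law of large numbers and irreducibility: [g_y(0) >= e^(- delta t)] for
      every [delta > 0] as soon as [y] is close to [t M] and [t] is large.
    - Ratio limit: a power [nu] of the lazy walk dominates [c (1 + X)], with [X]
      the translation by a unit vector, so that [nu ^ n] contains a binomial
      number of such translations.  Consecutive binomial coefficients have ratio
      at most [1 + eps] outside an exponentially small event, whence
      [g_y(z + w) <= (1 + eps) g_y(z) + C e^(- c t)].  By the lower bound the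
      error term is negligible for [|z| <= eta t].
    - For [|z| > eta t] the bounds [g_y <= C] and [g_y(0) >= e^(- delta t)]
      suffice, because of the weight. *)

(** * Sums over the lattice *)

(** Subtracting the constant [g_y(0)] shapes the argument. With [f] equal to [g_y - g_y(0)] on the
    orthant and to [0] outside, the decomposition up to time [n] has main part
    [G_n(x, y) - g_y(0) P_x(tau > n)], and apart from a vanishing tail its error involves only
    [g_y - g_y(0)], at [x] and at the exit position. An exponential weight is affordable because
    positive drift gives [phi(- s e_i) < 1] for all [i] and a small [s], while [exp(- s z_i) >= 1]
    once [z_i <= 0]; convexity of [phi] leaves room for a further small exponential.

    The obstacle in the ratio limit is periodicity: a power of [mu] and its translate may have
    disjoint supports. Passing to the lazy walk is harmless since its Green function is twice the
    original one. The error of the ratio step is additive, hence useful only where [g_y] is not too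
    small; so the lower bound must allow a rate [delta] chosen after the rate [c] of that step.

    Everything is done with operators on bounded functions; the probability space enters only at the
    end. *)

Section EsumReal.
Variables (R : realType) (I : choiceType).
Implicit Types (D : set I) (f g : I -> R).

(** The upper bound holds for every factor; applied to [c^-1] and [c * f] it gives the lower one. *)
Lemma esumZl D f (c : R) : 0 <= c -> (forall z, 0 <= f z) ->
  \esum_(z in D) (c * f z)%:E = (c%:E * \esum_(z in D) (f z)%:E)%E.
Proof.
have le1 (k : R) (u : I -> R) : 0 <= k -> (forall z, 0 <= u z) ->
    (\esum_(z in D) (k * u z)%:E <= k%:E * \esum_(z in D) (u z)%:E)%E.
  move=> k0 u0; apply: ge_ereal_sup => _ [X [finX XD] <-].
  under eq_fsbigr do rewrite EFinM.
  rewrite -ge0_mule_fsumr; last by move=> i; rewrite lee_fin.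
  by apply: lee_wpmul2l; rewrite ?lee_fin//; apply: esum_ge; exists X.
move=> c0 f0; apply/eqP; rewrite eq_le le1//=.
move: c0; rewrite [0 <= c]le_eqVlt => /orP[/eqP<-|c0].
  by rewrite mul0e; apply: esum_ge0 => z _; rewrite mul0r.
have cV : 0 <= c^-1 by rewrite invr_ge0 ltW.
have := le1 c^-1 (fun z => c * f z) cV (fun z => mulr_ge0 (ltW c0) (f0 z)).
rewrite (_ : (fun z => _) = (fun z => (f z)%:E)) => [h|]; last first.
  by apply/funext => z; rewrite mulrA mulVf ?gt_eqF// mul1r.
rewrite (le_trans (lee_wpmul2l _ h)) ?lee_fin ?(ltW c0)//.
by rewrite muleA -EFinM divff ?gt_eqF// mul1e.
Qed.

Definition summ D f : Prop := \esum_(z in D) (`|f z|)%:E \is a fin_num.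

Lemma le_summ D f g : (forall z, D z -> `|f z| <= g z) -> summ D g -> summ D f.
Proof.
move=> fg; rewrite /summ; apply: contraTT => /fin_numPn[h|h].
  by have := esum_ge0 (fun z (_ : D z) => normr_ge0 (f z) : (0 <= (`|f z|)%:E)%E);
     rewrite h.
suff -> : \esum_(z in D) (`|g z|)%:E = +oo%E by [].
apply/eqP; rewrite -leye_eq -h; apply: le_esum => z Dz; rewrite lee_fin.
by rewrite (le_trans (fg z Dz))// ler_norm.
Qed.

Lemma summ_nneg D f : (forall z, 0 <= f z) -> summ D f ->
  \esum_(z in D) (f z)%:E \is a fin_num.
Proof. by move=> f0; rewrite /summ; under eq_esum do rewrite ger0_norm//. Qed.

Lemma summD D f g : summ D f -> summ D g -> summ D (fun z => f z + g z).
Proof.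
move=> sf sg; apply: (@le_summ _ _ (fun z => `|f z| + `|g z|)).
  by move=> z _; exact: ler_normD.
rewrite /summ; under eq_esum do rewrite ger0_norm ?addr_ge0//= EFinD.
by rewrite esumD// fin_numD sf sg.
Qed.

Lemma summZ D f c : summ D f -> summ D (fun z => c * f z).
Proof.
move=> sf; rewrite /summ; under eq_esum do rewrite normrM.
by rewrite esumZl// fin_numM.
Qed.

End EsumReal.

Section Lsum.
Variables (R : realType) (d : nat).
Local Notation V := 'rV[int]_d.
Implicit Types (D : set V) (f g : V -> R).

Lemma lsum_nneg D f : (forall z, 0 <= f z) ->
  lsum D f = fine (\esum_(z in D) (f z)%:E).
Proof.
move=> f0; rewrite /lsum [X in _ - fine X]esum1 ?subr0; last first.
  by move=> z _; rewrite max_r// oppr_le0.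
by congr fine; apply: eq_esum => z _; rewrite max_l.
Qed.

Lemma lsum_nnegE D f : (forall z, 0 <= f z) -> summ D f ->
  (lsum D f)%:E = \esum_(z in D) (f z)%:E.
Proof. by move=> f0 sf; rewrite lsum_nneg// fineK// summ_nneg. Qed.

Let maxD D f : summ D f -> summ D (fun z => Num.max (f z) 0).
Proof.
move=> sf; apply: (@le_summ _ _ _ _ (fun z => `|f z|)); last first.
  by rewrite /summ; under eq_esum do rewrite normr_id.
by move=> z _; case: (leP (f z) 0) => h; rewrite ?normr0// ler_norm.
Qed.

Lemma summN D f : summ D f -> summ D (fun z => - f z).
Proof. by rewrite /summ; under [in X in _ -> X]eq_esum do rewrite normrN. Qed.

Let lsumE D f : lsum D f = lsum D (fun z => Num.max (f z) 0)
  - lsum D (fun z => Num.max (- f z) 0).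
Proof. by rewrite [X in X - _]lsum_nneg ?[X in _ - X]lsum_nneg// => z;
  rewrite le_max lexx orbT. Qed.

Let lsumD0 D f g : (forall z, 0 <= f z) -> (forall z, 0 <= g z) ->
  summ D f -> summ D g ->
  lsum D (fun z => f z + g z) = lsum D f + lsum D g.
Proof.
move=> f0 g0 sf sg; apply: EFin_inj.
have fg0 z : 0 <= f z + g z by rewrite addr_ge0.
rewrite [RHS]EFinD !lsum_nnegE//; last exact: summD.
under eq_esum do rewrite EFinD.
by rewrite esumD// => z _; rewrite lee_fin.
Qed.

(** Positive parts are not additive, but [(f+g)^+ + f^- + g^- = (f+g)^- + f^+ + g^+] has only
    nonnegative terms, for which [\esum] is additive. *)
Lemma lsumD D f g : summ D f -> summ D g ->
  lsum D (fun z => f z + g z) = lsum D f + lsum D g.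
Proof.
move=> sf sg; rewrite (lsumE _ (fun z => f z + g z)) (lsumE _ f) (lsumE _ g).
have m0 (x : R) : 0 <= Num.max x 0 by rewrite le_max lexx orbT.
have sfg := summD sf sg.
pose p u (z : V) : R := Num.max (u z) 0; pose n u (z : V) : R := Num.max (- u z) 0.
have sp u : summ D u -> summ D (p u) by exact: maxD.
have sn u : summ D u -> summ D (n u) by move=> h; apply: maxD; exact: summN.
have p0 u z : 0 <= p u z by exact: m0.
have n0 u z : 0 <= n u z by exact: m0.
have E (u v w : V -> R) : summ D u -> summ D v -> summ D w -> (forall z, 0 <= u z) ->
    (forall z, 0 <= v z) -> (forall z, 0 <= w z) ->
    lsum D u + (lsum D v + lsum D w) = lsum D (fun z => u z + (v z + w z)).
  move=> su sv sw u0 v0 w0; rewrite [RHS]lsumD0//; last exact: summD.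
    by rewrite [in RHS]lsumD0.
  by move=> z; rewrite addr_ge0.
have := E _ _ _ (sp _ sfg) (sn _ sf) (sn _ sg) (p0 _) (n0 _) (n0 _).
have := E _ _ _ (sn _ sfg) (sp _ sf) (sp _ sg) (n0 _) (p0 _) (p0 _).
have -> : (fun z => n (fun z => f z + g z) z + (p f z + p g z)) =
          (fun z => p (fun z => f z + g z) z + (n f z + n g z)).
  apply/funext => z; rewrite /p /n.
  have mE (x : R) : Num.max x 0 = x + Num.max (- x) 0.
    by case: (leP x 0); case: (leP (- x) 0); lra.
  by rewrite (mE (f z + g z)) (mE (f z)) (mE (g z)); ring.
by rewrite /p /n => h1 h2; lra.
Qed.

Lemma lsumN D f : lsum D (fun z => - f z) = - lsum D f.
Proof. by rewrite /lsum opprB; under [X in _ - fine X]eq_esum do rewrite opprK. Qed.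

Lemma lsumZ D f c : summ D f -> lsum D (fun z => c * f z) = c * lsum D f.
Proof.
wlog c0 : c / 0 <= c => [hw sf|].
  have [c0|c0] := leP 0 c; first exact: hw.
  rewrite (_ : (fun z => _) = fun z => - (- c * f z)); last first.
    by apply/funext => z; rewrite mulNr opprK.
  by rewrite lsumN hw// ?mulNr ?opprK// oppr_ge0 ltW.
move=> sf; rewrite /lsum mulrBr; congr (_ - _).
- under eq_esum => z _ do rewrite -[X in Num.max _ X](mulr0 c) -maxr_pMr//.
  rewrite esumZl//; last by move=> z; rewrite le_max lexx orbT.
  by rewrite fineM// summ_nneg//; [move=> z; rewrite le_max lexx orbT|exact: maxD].
- under eq_esum => z _ do
    rewrite -mulrN -[X in Num.max _ X](mulr0 c) -maxr_pMr//.
  rewrite esumZl//; last by move=> z; rewrite le_max lexx orbT.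
  rewrite fineM// summ_nneg//; first by move=> z; rewrite le_max lexx orbT.
  by apply: maxD; exact: summN.
Qed.

Lemma lsum_ge0 D f : (forall z, 0 <= f z) -> 0 <= lsum D f.
Proof.
by move=> f0; rewrite lsum_nneg// fine_ge0// esum_ge0// => z _; rewrite lee_fin.
Qed.

Lemma le_lsum D f g : summ D f -> summ D g -> (forall z, f z <= g z) ->
  lsum D f <= lsum D g.
Proof.
move=> sf sg fg; rewrite -subr_ge0 -lsumN -lsumD//; last exact: summN.
by apply: lsum_ge0 => z; rewrite subr_ge0.
Qed.

Lemma lsum_mkcond D f : lsum D f = lsum setT (fun z => (z \in D)%:R * f z).
Proof.
rewrite /lsum !(esum_mkcond D); congr (fine _ - fine _); apply: eq_esum => z _.
  by case: ifP; rewrite ?mul1r// mul0r maxxx.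
by case: ifP; rewrite ?mul1r// mul0r oppr0 maxxx.
Qed.

Lemma lsum_shift f (x : V) : lsum setT (fun z => f (z - x)) = lsum setT f.
Proof.
have e (u : V -> \bar R) :
    \esum_(z in setT) u z = \esum_(z in setT) u (z - x).
  apply: (@reindex_esum R _ _ setT setT (fun z => z - x)); split => //.
    by move=> z z' _ _ /addIr.
  by move=> z _; exists (z + x); rewrite ?addrK.
by rewrite /lsum; congr (fine _ - fine _); rewrite [RHS]e.
Qed.

End Lsum.

(** * The transition operator on bounded functions *)

Section Step.
Variables (R : realType) (d : nat).
Local Notation V := 'rV[int]_d.
Variables (mu : V -> R) (hmu : prob_mass mu).
Implicit Types (f g : V -> R) (x y z : V).

Definition bd f : Prop := exists C, forall z, `|f z| <= C.

Definition step f : V -> R := fun x => lsum setT (fun z => mu z * f (x + z)).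

Lemma bdD f g : bd f -> bd g -> bd (fun z => f z + g z).
Proof.
move=> [C hC] [C' hC']; exists (C + C') => z.
by rewrite (le_trans (ler_normD _ _))// lerD.
Qed.

Lemma bdZ c f : bd f -> bd (fun z => c * f z).
Proof. by move=> [C hC]; exists (`|c| * C) => z; rewrite normrM ler_wpM2l. Qed.

Lemma bd_cst c : bd (fun=> c).
Proof. by exists `|c|. Qed.

Lemma bd_le C f : (forall z, 0 <= f z <= C) -> bd f.
Proof. by move=> h; exists C => z; have /andP[? ?] := h z; rewrite ger0_norm. Qed.

Lemma bd_abs f : bd f -> bd (fun z => `|f z|).
Proof. by move=> [C hC]; exists C => z; rewrite normr_id. Qed.

Lemma bd_shift w f : bd f -> bd (fun z => f (z + w)).
Proof. by move=> [C hC]; exists C => z. Qed.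

Lemma bd_ind (p : V -> bool) f : bd f -> bd (fun z => (p z)%:R * f z).
Proof.
move=> [C hC]; exists C => z; case: (p z); rewrite ?mul1r ?mul0r// normr0.
exact: le_trans (hC z).
Qed.

Let mu0 z : 0 <= mu z. Proof. exact: hmu.1. Qed.

Lemma summ_mass : summ setT mu.
Proof. by rewrite /summ; under eq_esum do rewrite ger0_norm//; rewrite hmu.2. Qed.

Lemma lsum_mass : lsum setT mu = 1.
Proof. by rewrite lsum_nneg// hmu.2. Qed.

Lemma summ_step f x : bd f -> summ setT (fun z => mu z * f (x + z)).
Proof.
move=> [C hC]; apply: (@le_summ _ _ _ _ (fun z => C * mu z)).
  by move=> z _; rewrite normrM ger0_norm// mulrC ler_wpM2r.
exact: summZ summ_mass.
Qed.

Lemma stepD f g : bd f -> bd g ->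
  step (fun z => f z + g z) = (fun x => step f x + step g x).
Proof.
move=> bf bg; apply/funext => x; rewrite /step -lsumD; [|exact: summ_step..].
by congr lsum; apply/funext => z; rewrite mulrDr.
Qed.

Lemma stepZ c f : bd f -> step (fun z => c * f z) = (fun x => c * step f x).
Proof.
move=> bf; apply/funext => x; rewrite /step -lsumZ; last exact: summ_step.
by congr lsum; apply/funext => z; rewrite mulrCA.
Qed.

Lemma step_ge0 f x : (forall z, 0 <= f z) -> 0 <= step f x.
Proof. by move=> f0; apply: lsum_ge0 => z; rewrite mulr_ge0. Qed.

Lemma step_le f g x : bd f -> bd g -> (forall z, f z <= g z) ->
  step f x <= step g x.
Proof.
move=> bf bg fg; apply: le_lsum; [exact: summ_step..|] => z.
by rewrite ler_wpM2l.
Qed.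

Lemma step_cst c : step (fun=> c) = (fun=> c).
Proof.
apply/funext => x; rewrite /step; under eq_fun do rewrite mulrC.
by rewrite lsumZ ?lsum_mass ?mulr1//; exact: summ_mass.
Qed.

Lemma step_abs f x : bd f -> `|step f x| <= step (fun z => `|f z|) x.
Proof.
move=> bf; have ba := bd_abs bf; rewrite ler_norml; apply/andP; split.
  rewrite -mulN1r.
  have := stepZ (-1) ba => /(congr1 (fun u => u x)) /= <-.
  by apply: step_le => //; [exact: bdZ|move=> z; have := ler_norm (- f z); rewrite normrN; lra].
by apply: step_le => // z; rewrite ler_norm.
Qed.

Lemma bd_step f : bd f -> bd (step f).
Proof.
move=> bf; have [C hC] := bf; exists C => x.
rewrite (le_trans (step_abs _ bf))//.
rewrite -[leRHS](congr1 (fun u => u x) (step_cst C)).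
by apply: step_le => //; [exact: bd_abs|exact: bd_cst].
Qed.

Lemma step_shift w f : step (fun z => f (z + w)) = (fun x => step f (x + w)).
Proof.
apply/funext => x; congr lsum; apply/funext => z.
by rewrite -addrA (addrC z) addrA.
Qed.

Lemma step_fin (s : seq V) f x : uniq s -> bd f ->
  step (fun z => (z - x \in s)%:R * f z) x = \sum_(z <- s) mu z * f (x + z).
Proof.
move=> us bf; elim: s us => [_|a s IHs /= /andP[ans us]].
  rewrite big_nil (_ : (fun z => _) = fun=> 0) ?step_cst//.
  by apply/funext => z; rewrite in_nil mul0r.
rewrite big_cons -IHs//.
rewrite (_ : (fun z => _) = (fun z => (z - x == a)%:R * f z + (z - x \in s)%:R * f z)); last first.
  apply/funext => z; rewrite in_cons -mulrDl.
  by case: eqVneq => [->|] /=; rewrite ?(negPf ans) ?addr0 ?add0r.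
rewrite stepD; [|exact: (@bd_ind (fun z => z - x == a))
                |exact: (@bd_ind (fun z => z - x \in s))].
congr (_ + _); rewrite /step.
rewrite (_ : (fun z => _) = (fun z => (z \in [set a])%:R * (mu a * f (x + a)))).
  have nn (c : R) : 0 <= c -> lsum setT (fun z => (z \in [set a])%:R * c) = c.
    move=> c0; rewrite -(lsum_mkcond [set a] (fun=> c)) lsum_nneg// esum_set1//.
  have [c0|c0] := leP 0 (mu a * f (x + a)); first exact: nn.
  rewrite -[RHS]opprK -(nn (- (mu a * f (x + a)))) ?oppr_ge0 ?ltW// -lsumN.
  by congr lsum; apply/funext => z; rewrite mulrN opprK.
apply/funext => z; rewrite (addrC x z) addrK.
case: eqVneq => [->|za]; first by rewrite mem_set//= !mul1r addrC.
by rewrite memNset ?mul0r ?mulr0//=; exact/eqP.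
Qed.

Lemma mass_tight e : 0 < e -> exists s : seq V, uniq s /\ 1 - e < \sum_(z <- s) mu z.
Proof.
move=> e0; have : ((1 - e)%:E < \esum_(z in setT) (mu z)%:E)%E.
  by rewrite hmu.2 lte_fin ltrBlDr ltrDl.
move=> /ereal_sup_gt[_ [X [finX _] <-]]; rewrite fsbig_finite//= sumEFin lte_fin.
by move=> h; exists (enum_fset (fset_set X)); split; [exact: fset_uniq|].
Qed.

Lemma step_ge_atom f x z : bd f -> (forall z, 0 <= f z) ->
  mu z * f (x + z) <= step f x.
Proof.
move=> bf f0.
have := @step_fin [:: z] f x isT bf; rewrite big_cons big_nil addr0 => <-.
apply: step_le => //; first exact: (@bd_ind (fun u => u - x \in [:: z])).
by move=> u; case: (_ \in _); rewrite ?mul1r ?mul0r.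
Qed.

Lemma cvg_seq_sum (s : seq V) (u : nat -> V -> R) (f : V -> R) :
  (forall z, u n z @[n --> \oo] --> f z) ->
  (\sum_(z <- s) u n z) @[n --> \oo] --> \sum_(z <- s) f z.
Proof.
move=> uf; elim: s => [|a s IHs].
  by rewrite big_nil; under eq_fun do rewrite big_nil; exact: cvg_cst.
by rewrite big_cons; under eq_fun do rewrite big_cons; exact: cvgD.
Qed.

(** Bounded convergence by tightness: a finite set carries all but [e / (4 * (C + 1))] of the mass;
    on it the convergence is that of a finite sum, off it the error is at most [2 * C] times the
    missing mass. *)
Lemma step_cvg (u : nat -> V -> R) f C x :
  (forall n z, `|u n z| <= C) -> (forall z, u n z @[n --> \oo] --> f z) ->
  step (u n) x @[n --> \oo] --> step f x.
Proof.
move=> uC uf.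
have fC z : `|f z| <= C.
  by apply: (cvgr_to_le (cvg_norm (uf z))); exact: nearW.
have bf : bd f by exists C.
have C0 : 0 <= C by exact: le_trans (fC 0).
apply/cvgrPdist_le => e e0.
have e1 : 0 < e / (4 * (C + 1)) by rewrite divr_gt0// mulr_gt0// ltr_wpDl.
have [s [us hs]] := mass_tight e1.
pose w n z := `|f z - u n z|.
have bu n : bd (fun z => f z - u n z).
  by exists (C + C) => z; rewrite (le_trans (ler_normB _ _))// lerD.
have bw n : bd (w n) by exact: bd_abs.
have w2 n z : w n z <= 2 * C.
  by rewrite (le_trans (ler_normB _ _))// mulr2n mulrDl mul1r lerD.
have key n : `|step f x - step (u n) x| <=
    (\sum_(z <- s) mu z * w n (x + z)) + e / 2.
  have bun : bd (fun z => - 1 * u n z) by apply: bdZ; exists C.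
  have -> : step f x - step (u n) x = step (fun z => f z - u n z) x.
    under [in RHS]eq_fun do rewrite -mulN1r.
    by rewrite stepD// stepZ ?mulN1r//; exists C.
  apply: le_trans (step_abs _ (bu n)) _.
  rewrite -step_fin//.
  pose p z := (z - x \in s)%:R : R.
  have bp c : bd (fun z => p z * c).
    by apply: (@bd_ind (fun z => z - x \in s)); exact: bd_cst.
  (* Outside the window [w n] is replaced by [2 * C], written as a constant minus its restriction to
     the window, so that linearity and [step_fin] apply. *)
  have h : step (fun z => w n z) x <=
      step (fun z => p z * w n z + ((2 * C) * 1 + (- 1) * (p z * (2 * C)))) x.
    apply: step_le => //.
      apply: bdD; first exact: (@bd_ind (fun z => z - x \in s)).
      by apply: bdD; [exact: bd_cst|apply: bdZ].
    move=> z; rewrite /p; case: (_ \in _); last by rewrite !mul0r mulr0 addr0 add0r mulr1.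
    by rewrite !mul1r mulr1 mulN1r subrr addr0.
  apply: (le_trans h).
  rewrite stepD; [|exact: (@bd_ind (fun z => z - x \in s))
     |by apply: bdD; [exact: bd_cst|apply: bdZ]].
  rewrite lerD2l stepD; [|exact: bd_cst|by apply: bdZ].
  have Hp : step (fun z => p z * (2 * C)) x = \sum_(z <- s) mu z * (2 * C).
    exact: (step_fin x us (bd_cst (2 * C))).
  rewrite (step_cst (2 * C * 1)) (stepZ (-1))// Hp -mulr_suml mulr1 mulN1r.
  have -> : 2 * C - (\sum_(z <- s) mu z) * (2 * C) =
    (1 - \sum_(z <- s) mu z) * (2 * C) by ring.
  have : 1 - \sum_(z <- s) mu z <= e / (4 * (C + 1)) by lra.
  move=> /(ler_wpM2r (_ : 0 <= 2 * C)) => /(_ ltac:(lra)) /le_trans; apply.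
  rewrite mulrAC ler_pdivrMr; last by rewrite mulr_gt0// ltr_wpDl.
  have : 0 <= e * C by rewrite mulr_ge0// ltW.
  by nra.
have : (\sum_(z <- s) mu z * w n (x + z)) @[n --> \oo] --> \sum_(z <- s) (mu z * 0).
  apply: (@cvg_seq_sum s (fun n z => mu z * w n (x + z)) (fun z => mu z * 0)) => z.
  apply: cvgZr; rewrite -(normr0 R) -(subrr (f (x + z))); apply: cvg_norm.
  by apply: cvgB; [exact: cvg_cst|exact: uf].
rewrite big1; last by move=> z _; rewrite mulr0.
move=> /cvgrPdist_le /(_ (e / 2)) => /(_ ltac:(lra)) h.
near=> n; apply: (le_trans (key n)).
rewrite [leRHS](splitr e) lerD2r.
have : `|0 - \sum_(z <- s) mu z * w n (x + z)| <= e / 2 by near: n.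
by rewrite sub0r normrN => /(le_trans (ler_norm _)).
Unshelve. all: by end_near. Qed.

(** Exponentials are eigenfunctions of the operator, with eigenvalue [laplace mu a]; being
    unbounded, they appear only as majorants of a bounded [f]. *)
Lemma step_exp f a L C x : (laplace mu a <= L%:E)%E -> 0 <= C -> bd f ->
  (forall z, 0 <= f z) -> (forall z, f z <= C * expR (dotp a (intv R z))) ->
  step f x <= C * L * expR (dotp a (intv R x)).
Proof.
move=> hL C0 bf f0 fe.
rewrite -lee_fin lsum_nnegE; last exact: summ_step.
  apply: (@le_trans _ _ (\esum_(z in setT)
     ((C * expR (dotp a (intv R x))) * (mu z * expR (dotp a (intv R z))))%:E)).
    apply: le_esum => z _; rewrite lee_fin [leRHS]mulrCA ler_wpM2l//.
    rewrite (le_trans (fe _))// -mulrA ler_wpM2l// -expRD le_eqVlt; apply/orP; left.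
    apply/eqP; congr expR; rewrite /dotp -big_split/=; apply: eq_bigr => i _.
    by rewrite -mulrDr !mxE intrD.
  rewrite esumZl; first last.
  - by move=> z; rewrite mulr_ge0// expR_ge0.
  - by rewrite mulr_ge0// expR_ge0.
  rewrite -mulrA (mulrC L) mulrA [leRHS]EFinM; apply: lee_wpmul2l => //.
  by rewrite lee_fin mulr_ge0// expR_ge0.
by move=> z; rewrite mulr_ge0.
Qed.

End Step.

(** * Comparison of a power of a kernel with its translate *)

Section Ratio.
Variables (R : realType) (d : nat).
Local Notation V := 'rV[int]_d.
Implicit Types (f g : V -> R) (x y z : V) (O : (V -> R) -> V -> R).

(** The properties shared by the step operator, its lazy version, their powers and the remainder [r]
    below. They are asked on bounded functions only, where [lsum] is a genuine sum. *)
Record tiop O : Prop := Tiop {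
  ti_bd : forall f, bd f -> bd (O f);
  tiD : forall f g, bd f -> bd g ->
    O (fun z => f z + g z) = (fun x => O f x + O g x);
  tiZ : forall c f, bd f -> O (fun z => c * f z) = (fun x => c * O f x);
  ti_ge0 : forall f, bd f -> (forall z, 0 <= f z) -> forall x, 0 <= O f x;
  ti_shift : forall w f, bd f -> O (fun z => f (z + w)) = (fun x => O f (x + w)) }.

Lemma tiop_le O f g x : tiop O -> bd f -> bd g -> (forall z, f z <= g z) ->
  O f x <= O g x.
Proof.
move=> tO bf bg fg; rewrite -subr_ge0.
have bN : bd (fun z => -1 * f z) by exact: bdZ.
have -> : O g x - O f x = O (fun z => g z + -1 * f z) x.
  by rewrite (tiD tO)// (tiZ tO)// mulN1r.
apply: (ti_ge0 tO) => [|z]; first exact: bdD.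
by rewrite mulN1r subr_ge0.
Qed.

Lemma tiop_id : tiop id.
Proof. by split. Qed.

Lemma tiop_comp O O' : tiop O -> tiop O' -> tiop (fun f => O (O' f)).
Proof.
move=> tO tO'; have b' := ti_bd tO'; split.
- by move=> f bf; apply: (ti_bd tO); exact: b'.
- by move=> f g bf bg; rewrite (tiD tO')// (tiD tO)//; exact: b'.
- by move=> c f bf; rewrite (tiZ tO')// (tiZ tO)//; exact: b'.
- by move=> f bf f0; apply: (ti_ge0 tO); [exact: b'|exact: (ti_ge0 tO')].
- by move=> w f bf; rewrite (ti_shift tO')// (ti_shift tO)//; exact: b'.
Qed.

Lemma tiop_iter O n : tiop O -> tiop (iter n O).
Proof.
by move=> tO; elim: n => [|n IHn]; [exact: tiop_id|exact: tiop_comp].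
Qed.

Lemma tiop_step (mu : V -> R) : prob_mass mu -> tiop (step mu).
Proof.
move=> hmu; split.
- exact: bd_step.
- exact: stepD.
- exact: stepZ.
- by move=> f bf f0 x; exact: step_ge0.
- by move=> w f _; exact: step_shift.
Qed.

Definition lazy O f : V -> R := fun x => 2^-1 * f x + 2^-1 * O f x.

Lemma tiop_lazy O : tiop O -> tiop (lazy O).
Proof.
move=> tO; split.
- by move=> f bf; apply: bdD; apply: bdZ => //; exact: ti_bd.
- by move=> f g bf bg; apply/funext => x; rewrite /lazy (tiD tO)//; ring.
- by move=> c f bf; apply/funext => x; rewrite /lazy (tiZ tO)//; ring.
- move=> f bf f0 x; rewrite /lazy addr_ge0// mulr_ge0//.
  exact: (ti_ge0 tO).
- by move=> w f bf; apply/funext => x; rewrite /lazy (ti_shift tO).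
Qed.

Section Omega.
Variables (nu : (V -> R) -> V -> R) (tnu : tiop nu) (nu1 : forall c, nu (fun=> c) = fun=> c).
Variables (w : V) (c : R) (c0 : 0 <= c).
Hypothesis nu_ge : forall f, bd f -> (forall z, 0 <= f z) ->
  forall x, c * f x + c * f (x + w) <= nu f x.

Let r f : V -> R := fun x => nu f x + (- c * f x + - c * f (x + w)).

Let tr : tiop r.
Proof.
split.
- move=> f bf; apply: bdD; first exact: (ti_bd tnu).
  by apply: bdD; apply: bdZ => //; exact: bd_shift.
- by move=> f g bf bg; apply/funext => x; rewrite /r (tiD tnu)//; ring.
- by move=> k f bf; apply/funext => x; rewrite /r (tiZ tnu)//; ring.
- by move=> f bf f0 x; rewrite /r; have := nu_ge bf f0 x; lra.
- move=> v f bf; apply/funext => x; rewrite /r (ti_shift tnu)//.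
  by rewrite -!addrA (addrC v w).
Qed.

Variables (f : V -> R) (m : R) (fm : forall z, 0 <= f z <= m).

Let bf : bd f. Proof. exact: bd_le fm. Qed.
Let f0 z : 0 <= f z. Proof. by have /andP[] := fm z. Qed.
Let m0 : 0 <= m. Proof. by have /andP[h1 h2] := fm 0; exact: le_trans h2. Qed.

(* [nu = c + c X + r], with [X] the translation by [w]; expanding [nu ^ n]
   gives words in the letters [c], [c X], [r], and [Om n u] is the sum of the
   words with [a] letters [c] and [b] letters [c X], weighted by [u a b]. *)
Fixpoint Om n (u : nat -> nat -> R) : V -> R :=
  if n is n'.+1 then fun x =>
    c * Om n' (fun a b => u a.+1 b) x +
    (c * Om n' (fun a b => u a b.+1) (x + w) + r (Om n' u) x)
  else fun x => u 0%N 0%N * f x.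

Let bd_Om n u : bd (Om n u).
Proof.
elim: n u => [|n IHn] u /=; first exact: bdZ.
apply: bdD; first exact: bdZ.
apply: bdD; last by exact: (ti_bd tr).
by apply: bdZ; exact: (@bd_shift _ _ _ (Om n _)).
Qed.

Let Om_le n u v x : (forall a b, u a b <= v a b) -> Om n u x <= Om n v x.
Proof.
elim: n u v x => [|n IHn] u v x uv /=; first by rewrite ler_wpM2r.
apply: lerD; first by apply: ler_wpM2l => //; exact: IHn.
apply: lerD; first by apply: ler_wpM2l => //; exact: IHn.
by apply: (tiop_le _ tr) => // z; exact: IHn.
Qed.

Let OmD n u v x : Om n (fun a b => u a b + v a b) x = Om n u x + Om n v x.
Proof.
elim: n u v x => [|n IHn] u v x /=; first by rewrite mulrDl.
have -> : Om n (fun a b => u a b + v a b) = fun z => Om n u z + Om n v z.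
  by apply/funext => z; exact: IHn.
by rewrite !IHn (tiD tr)//; ring.
Qed.

Let OmZ n k u x : Om n (fun a b => k * u a b) x = k * Om n u x.
Proof.
elim: n u x => [|n IHn] u x /=; first by rewrite mulrA.
have -> : Om n (fun a b => k * u a b) = fun z => k * Om n u z.
  by apply/funext => z; exact: IHn.
by rewrite !IHn (tiZ tr)//; ring.
Qed.

Let Om1 n : Om n (fun _ _ => 1) = iter n nu f.
Proof.
elim: n => [|n IHn] /=; first by apply/funext => z; rewrite mul1r.
by apply/funext => z; rewrite IHn /r; ring.
Qed.

(* With [nu_(p,q) = c (p + q X) + r], this is [X d/dp = d/dq] for [nu_(p,q) ^ n]. *)
Let Om_swap n v x : Om n (fun a b => a%:R * v a.-1 b) (x + w) =
  Om n (fun a b => b%:R * v a b.-1) x.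
Proof.
elim: n v x => [|n IHn] v x /=; first by rewrite !mul0r.
have E1 z : Om n (fun a b => a.+1%:R * v a b) (z + w) =
    Om n v (z + w) + Om n (fun a b => b%:R * v a.+1 b.-1) z.
  rewrite -(IHn (fun a b => v a.+1 b)) -OmD; congr (Om n _ _).
  apply/funext => a; apply/funext => b; case: a => [|a] /=; last by ring.
  by rewrite mul1r mul0r addr0.
have E2 z : Om n (fun a b => b.+1%:R * v a b) z =
    Om n v z + Om n (fun a b => a%:R * v a.-1 b.+1) (z + w).
  rewrite (IHn (fun a b => v a b.+1)) -OmD; congr (Om n _ _).
  apply/funext => a; apply/funext => b; case: b => [|b] /=; last by ring.
  by rewrite mul1r mul0r addr0.
have E3 : r (Om n (fun a b => a%:R * v a.-1 b)) (x + w) =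
    r (Om n (fun a b => b%:R * v a b.-1)) x.
  have := ti_shift tr w (bd_Om n (fun a b => a%:R * v a.-1 b)).
  move=> /(congr1 (fun u => u x)) <-; congr (r _ x).
  by apply/funext => z; exact: IHn.
by rewrite E1 E2 E3; ring.
Qed.

(** Multiplicative weights rescale the letters: the result is the [n]-th power of the kernel
    [c al + c be X + r], of total mass [c * al + c * be + (1 - 2 * c)], applied to a function
    bounded by [m]. *)
Let Om_exp n k al be x : 0 <= k -> 0 <= al -> 0 <= be ->
  Om n (fun a b => k * (al ^+ a * be ^+ b)) x
    <= k * (c * al + c * be + (1 - 2 * c)) ^+ n * m.
Proof.
move=> k0 al0 be0; rewrite OmZ -mulrA; apply: ler_wpM2l => //.
set q := c * al + _ + _.
elim: n x => [|n IHn] x /=.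
  by rewrite !expr0 !mul1r; have /andP[] := fm x.
have -> : (fun a b => al ^+ a.+1 * be ^+ b) = fun a b => al * (al ^+ a * be ^+ b).
  by apply/funext => a; apply/funext => b; rewrite exprS -mulrA.
have -> : (fun a b => al ^+ a * be ^+ b.+1) = fun a b => be * (al ^+ a * be ^+ b).
  by apply/funext => a; apply/funext => b; rewrite exprS mulrCA.
rewrite !OmZ exprS.
have h : r (Om n (fun a b => al ^+ a * be ^+ b)) x <= (1 - 2 * c) * (q ^+ n * m).
  have := tiop_le x tr (bd_Om n (fun a b => al ^+ a * be ^+ b)) (bd_cst d (q ^+ n * m)) IHn.
  by move=> /le_trans; apply; rewrite /r nu1; rewrite le_eqVlt; apply/orP; left; apply/eqP; ring.
have h1 := ler_wpM2l (mulr_ge0 c0 al0) (IHn x).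
have h2 := ler_wpM2l (mulr_ge0 c0 be0) (IHn (x + w)).
by rewrite /q in h h1 h2 *; lra.
Qed.

(* Words with [b + 1 <= (1 + e) a] are paired, by exchanging a letter [c] for a
   letter [c X], at the cost of a factor [1 + e]; the other words satisfy
   [1 <= e^(s (b + 1 - (1 + e) a))]. *)
Lemma ratio_shift n (e s : R) x : 0 < e -> 0 <= s ->
  iter n nu f (x + w) <= (1 + e) * iter n nu f x +
  expR s * (c * expR (- (s * (1 + e))) + c * expR s + (1 - 2 * c)) ^+ n * m.
Proof.
move=> e0 s0; rewrite -Om1.
(* For [a > 0], [a * v (a - 1) b] is the indicator of [b + 1 <= (1 + e) a], whereas
   [b * v a (b - 1)] never exceeds [1 + e]; [Om_swap] exchanges the two. *)
pose v (a b : nat) : R := if b.+1%:R <= (1 + e) * a.+1%:R then a.+1%:R^-1 else 0.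
have h1 := @Om_exp n (expR s) (expR (- (s * (1 + e)))) (expR s) (x + w)
  (expR_ge0 _) (expR_ge0 _) (expR_ge0 _).
have h2 : Om n (fun a b => a%:R * v a.-1 b) (x + w) <= (1 + e) * Om n (fun _ _ => 1) x.
  rewrite Om_swap -OmZ; apply: Om_le => a [|b]; rewrite mulr1 ?mul0r//=.
    by rewrite addr_ge0// ltW.
  rewrite /v; case: ifP => [hb|_]; last by rewrite mulr0 addr_ge0// ltW.
  by rewrite ler_pdivrMr.
apply: le_trans (lerD h2 h1); rewrite -OmD; apply: Om_le => a b.
rewrite /v -!expRM_natl -!expRD; case: a => [|a].
  by rewrite mul0r add0r mul0r add0r -[leLHS]expR0 ler_expR addr_ge0// mulr_ge0.
case: ifP => hb /=.
  by rewrite mulfV// lerDl expR_ge0.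
rewrite mulr0 add0r -[leLHS]expR0 ler_expR.
move: hb => /negbT; rewrite -ltNge => hb.
rewrite (_ : s + _ = s * (b.+1%:R - (1 + e) * a.+1%:R)); last first.
  by rewrite -[b.+1]addn1 natrD; ring.
by rewrite mulr_ge0// subr_ge0 ltW.
Qed.

End Omega.

(** At [s = 0] the expression equals [1] and its derivative is [- c * e], so a small [s] works. *)
Lemma ratio_rate (c e : R) : 0 < c -> 2 * c <= 1 -> 0 < e -> exists s : R, 0 < s /\
  0 <= c * expR (- (s * (1 + e))) + c * expR s + (1 - 2 * c) < 1.
Proof.
move=> c0 c1 e0; pose s : R := e / (4 * (1 + e)).
have e1 : 0 < 1 + e by lra.
have s0 : 0 < s by rewrite divr_gt0// mulr_gt0.
have sE : 4 * (s * (1 + e)) = e.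
  by rewrite /s; field; rewrite gt_eqF.
exists s; split => //; apply/andP; split.
  have h1 := mulr_ge0 (ltW c0) (expR_ge0 s).
  have h2 := mulr_ge0 (ltW c0) (expR_ge0 (- (s * (1 + e)))); lra.
have se0 : 0 < s * (1 + e) by rewrite mulr_gt0.
have s1 : s < 1 by nra.
have h1 : expR (- (s * (1 + e))) <= (1 + s * (1 + e))^-1.
  rewrite expRN lef_pV2 ?posrE ?expR_gt0//; last lra.
  exact: expR_ge1Dx.
have h2 : expR s <= (1 - s)^-1.
  rewrite -[s in expR s]opprK expRN lef_pV2 ?posrE ?expR_gt0//; last lra.
  exact: expR_ge1Dx.
suff : (1 + s * (1 + e))^-1 + (1 - s)^-1 < 2 by nra.
rewrite -[X in X + _]mul1r -[X in _ + X]mul1r addf_div ?gt_eqF; try lra.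
by rewrite ltr_pdivrMr ?mulr_gt0; nra.
Qed.

End Ratio.

(** * Exponential moments *)

(** The inverse of [1] plus the sum of the inverses serves as a minimum and also covers an empty
    [I]. *)
Lemma fin_lower (R : realType) (I : finType) (F : I -> R) :
  (forall i, 0 < F i) -> exists m, [/\ 0 < m, m <= 1 & forall i, m <= F i].
Proof.
move=> F0; have S0 : 0 <= \sum_i (F i)^-1.
  by apply: sumr_ge0 => i _; rewrite invr_ge0 ltW.
exists (1 + \sum_i (F i)^-1)^-1; split.
- by rewrite invr_gt0 ltr_wpDr.
- by rewrite invf_le1 ?ltr_wpDr// lerDl.
- move=> i; rewrite -[leRHS]invrK lef_pV2 ?posrE ?invr_gt0 ?ltr_wpDr//.
  rewrite (bigD1 i)//= addrCA lerDl addr_ge0// sumr_ge0// => j _.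
  by rewrite invr_ge0 ltW.
Qed.

(* Both cases follow from [e^v - 1 <= v e^v]. *)
Lemma expR_quad (R : realType) (v : R) : expR v <= 1 + v + v ^+ 2 * expR `|v|.
Proof.
have h1 := expR_ge1Dx v; have h2 := expR_ge1Dx (- v).
have e0 := expR_gt0 v; have eV : expR (- v) * expR v = 1 by rewrite expRN mulVf ?gt_eqF.
have h3 : expR v - 1 <= v * expR v by nra.
have [v0|v0] := leP 0 v; first by rewrite ger0_norm//; nra.
have h4 : 1 <= expR `|v| by have := expR_ge1Dx `|v|; have := normr_ge0 v; lra.
by nra.
Qed.

Lemma sqr_expR (R : realType) (v : R) : 0 <= v -> v ^+ 2 <= 4 * expR v.
Proof.
move=> v0; have h := expR_ge1Dx (v / 2).
have -> : expR v = expR (v / 2) * expR (v / 2) by rewrite -expRD -splitr.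
by nra.
Qed.

Lemma expR_abs (R : realType) (v : R) : expR `|v| <= expR v + expR (- v).
Proof.
by case: (leP 0 v) => v0; [rewrite ger0_norm// lerDl|rewrite ltr0_norm// lerDr]; rewrite expR_ge0.
Qed.

Section Mgf.
Variables (R : realType) (d : nat).
Local Notation V := 'rV[int]_d.
Variables (mu : V -> R) (hmu : prob_mass mu).

Definition dir (i : 'I_d) (s : R) : 'rV[R]_d := s *: delta_mx 0 i.

Lemma dotpDl (a b : 'rV[R]_d) (z : 'rV[R]_d) : dotp (a + b) z = dotp a z + dotp b z.
Proof. by rewrite /dotp -big_split/=; apply: eq_bigr => i _; rewrite !mxE mulrDl. Qed.

Lemma dotpZl c (a z : 'rV[R]_d) : dotp (c *: a) z = c * dotp a z.
Proof. by rewrite /dotp mulr_sumr; apply: eq_bigr => i _; rewrite !mxE mulrA. Qed.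

Lemma dotp_dir i s (z : V) : dotp (dir i s) (intv R z) = s * (z 0 i)%:~R.
Proof.
rewrite dotpZl /dotp (bigD1 i)//= big1 ?addr0 => [|j ji].
  by rewrite !mxE !eqxx mul1r.
by rewrite !mxE (negPf ji) andbF mul0r.
Qed.

Let mu0 z : 0 <= mu z. Proof. exact: hmu.1. Qed.

Lemma laplace_ge0 a : (0 <= laplace mu a)%E.
Proof. by apply: esum_ge0 => z _; rewrite lee_fin mulr_ge0// expR_ge0. Qed.

Lemma laplace_convex a b (l L1 L2 : R) : 0 <= l <= 1 ->
  (laplace mu a <= L1%:E)%E -> (laplace mu b <= L2%:E)%E ->
  (laplace mu (l *: a + (1 - l) *: b) <= (l * L1 + (1 - l) * L2)%:E)%E.
Proof.
move=> /andP[l0 l1] ha hb; have l1' : 0 <= 1 - l by rewrite subr_ge0.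
have ge0 (c : 'rV[R]_d) z : 0 <= mu z * expR (dotp c (intv R z)).
  by rewrite mulr_ge0// expR_ge0.
rewrite EFinD !EFinM.
apply: (@le_trans _ _ (l%:E * laplace mu a + (1 - l)%:E * laplace mu b)%E); last first.
  by apply: leeD; apply: lee_wpmul2l.
rewrite /laplace -!esumZl// -esumD; last 2 first.
- by move=> z _; rewrite lee_fin mulr_ge0.
- by move=> z _; rewrite lee_fin mulr_ge0.
apply: le_esum => z _; rewrite -EFinD lee_fin.
rewrite dotpDl !dotpZl; set u := dotp a _; set v := dotp b _.
rewrite (mulrCA l) (mulrCA (1 - l)) -mulrDr ler_wpM2l//.
set m := l * u + _.
(* Tangent to [expR] at the mean exponent [m]; the linear terms cancel in the convex combination. *)
have h (x : R) : expR m * (1 + (x - m)) <= expR x.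
  have -> : expR x = expR m * expR (x - m) by rewrite -expRD addrC subrK.
  by rewrite ler_wpM2l ?expR_ge0// expR_ge1Dx.
have hu := ler_wpM2l l0 (h u); have hv := ler_wpM2l l1' (h v).
have -> : expR m = l * (expR m * (1 + (u - m))) + (1 - l) * (expR m * (1 + (v - m))).
  by rewrite /m; ring.
exact: lerD.
Qed.

Lemma laplace0 : laplace mu 0 = 1%E.
Proof.
rewrite -hmu.2; apply: eq_esum => z _; rewrite -(scale0r 0) dotpZl mul0r expR0.
by rewrite mulr1.
Qed.

Hypothesis h_exp : set_nbhs (sublevel1 mu) [set a | (laplace mu a < +oo)%E].

(** Since [laplace mu 0 = 1], the origin lies in the sublevel set, around which the transform is
    finite. *)
Lemma mgf_fin : exists2 r : R, 0 < r &
  forall i s, `|s| <= r -> (laplace mu (dir i s) < +oo)%E.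
Proof.
have /nbhs_ballP[e /= e0 he] : nbhs (0 : 'rV[R]_d) [set a | (laplace mu a < +oo)%E].
  by apply: h_exp; rewrite /sublevel1/= laplace0.
exists (e / 2); first by rewrite divr_gt0.
move=> i s hs; apply: he; split => // k j.
rewrite -ball_normE/= !mxE sub0r normrN normrM.
apply: (@le_lt_trans _ _ `|s|); last by apply: le_lt_trans hs _; lra.
by rewrite ler_piMr//; case: (_ && _); rewrite ?normr1 ?normr0.
Qed.

(** For [|s| <= r / 2] the remainder [(s u)^2 exp |s u|] of the exponential is at most
    [s^2 (16 / r^2) exp (r |u|)], which is integrable. Summing over the coordinates makes [Q]
    independent of [i]. *)
Lemma mgf_taylor : exists r Q : R, [/\ 0 < r, 0 <= Q & forall i s, `|s| <= r ->
  (laplace mu (dir i s) <= (1 + s * drift mu 0 i + s ^+ 2 * Q)%:E)%E].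
Proof.
have [r r0 hr] := mgf_fin.
have sm i s : `|s| <= r -> summ setT (fun z => mu z * expR (s * (z 0 i)%:~R)).
  move=> hs; have := hr i s hs; rewrite /summ /laplace => h.
  under eq_esum do rewrite ger0_norm ?mulr_ge0 ?expR_ge0// -dotp_dir.
  by rewrite fin_numElt h (lt_le_trans (ltNyr 0))//; exact: laplace_ge0.
have rr : `|r| <= r by rewrite ger0_norm// ltW.
have rNr : `|- r| <= r by rewrite normrN.
pose q i z : R := mu z * expR (r * (z 0 i)%:~R) + mu z * expR (- r * (z 0 i)%:~R).
have sq i : summ setT (q i) by apply: summD; exact: sm.
have q0 i z : 0 <= q i z by rewrite addr_ge0// mulr_ge0 ?expR_ge0.
have qE i (z : V) : mu z * expR (r * `|(z 0 i)%:~R|) <= q i z.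
  rewrite /q -mulrDr ler_wpM2l// mulNr.
  by have := expR_abs (r * (z 0 i)%:~R); rewrite normrM (gtr0_norm r0).
pose K := 16 / r ^+ 2.
have K0 : 0 <= K by rewrite divr_ge0// sqr_ge0.
exists (r / 2), (\sum_i (K * lsum setT (q i))); split.
- by rewrite divr_gt0.
- by apply: sumr_ge0 => i _; rewrite mulr_ge0//; exact: lsum_ge0.
move=> i s hs.
have s1 : summ setT (fun z => mu z * (intv R z) 0 i).
  apply: (@le_summ _ _ _ _ (fun z => r^-1 * q i z)); last exact: summZ.
  move=> z _; rewrite normrM ger0_norm// !mxE.
  rewrite ler_pdivlMl// mulrCA.
  apply: le_trans (qE i z); rewrite ler_wpM2l//.
  by have := expR_ge1Dx (r * `|(z 0 i)%:~R|); lra.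
have s2 : summ setT (fun z => mu z + (s * (mu z * (intv R z) 0 i) + s ^+ 2 * (K * q i z))).
  apply: summD; first exact: summ_mass.
  by apply: summD; [exact: summZ|apply: summZ; exact: summZ].
have hs' : `|s| <= r by lra.
have -> : laplace mu (dir i s) = (lsum setT (fun z => mu z * expR (s * (z 0 i)%:~R)))%:E.
  rewrite lsum_nnegE//; [|by move=> z; rewrite mulr_ge0 ?expR_ge0|exact: sm].
  by apply: eq_esum => z _; rewrite dotp_dir.
rewrite lee_fin.
apply: (@le_trans _ _ (1 + s * drift mu 0 i + s ^+ 2 * (K * lsum setT (q i)))).
  have sKq : summ setT (fun z => K * q i z) by exact: summZ.
  have sA : summ setT (fun z => s * (mu z * (intv R z) 0 i)) by exact: summZ.
  have sB : summ setT (fun z => s ^+ 2 * (K * q i z)) by exact: summZ.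
  have -> : 1 + s * drift mu 0 i + s ^+ 2 * (K * lsum setT (q i)) =
      lsum setT (fun z => mu z + (s * (mu z * (intv R z) 0 i) + s ^+ 2 * (K * q i z))).
    rewrite (lsumD (summ_mass hmu) (summD sA sB)) (lsumD sA sB) (lsum_mass hmu).
    by rewrite (lsumZ s s1) (lsumZ _ sKq) (lsumZ _ (sq i)) /drift [in LHS]mxE addrA.
  apply: (@le_lsum _ _ setT _ _ (sm i s hs') s2) => z.
  rewrite !mxE; set u := (z 0 i)%:~R : R.
  have h1 := expR_quad (s * u).
  have h2 : (s * u) ^+ 2 * expR `|s * u| <= s ^+ 2 * (K * expR (r * `|u|)).
    rewrite exprMn -mulrA ler_wpM2l ?sqr_ge0//.
    have h3 := sqr_expR (_ : 0 <= r / 2 * `|u|).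
    have -> : expR (r * `|u|) = expR (r / 2 * `|u|) * expR (r / 2 * `|u|).
      by rewrite -expRD; congr expR; field.
    have h4 : expR `|s * u| <= expR (r / 2 * `|u|).
      by rewrite ler_expR normrM ler_wpM2r.
    have h5 : u ^+ 2 <= K * expR (r / 2 * `|u|).
      have /h3 : 0 <= r / 2 * `|u| by rewrite mulr_ge0// divr_ge0// ltW.
      rewrite /K exprMn real_normK ?num_real// => h.
      rewrite mulrAC ler_pdivlMr ?exprn_gt0//; nra.
    rewrite mulrA; apply: ler_pM => //; rewrite ?sqr_ge0 ?expR_ge0//.
  have h6 := qE i z; rewrite -/u in h6.
  have h7 := ler_wpM2l (mu0 z) h1; have h8 := ler_wpM2l (mu0 z) h2.
  apply: (le_trans h7); set X := _ ^+ 2 * expR _.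
  have -> : mu z * (1 + s * u + X) = mu z + (s * (mu z * u) + mu z * X) by ring.
  rewrite lerD2l lerD2l; apply: (le_trans h8).
  by rewrite [leLHS]mulrCA ler_wpM2l ?sqr_ge0// [leLHS]mulrCA ler_wpM2l.
rewrite lerD2l ler_wpM2l ?sqr_ge0// (bigD1 i)//= lerDl.
by apply: sumr_ge0 => j _; rewrite mulr_ge0//; exact: lsum_ge0.
Qed.

(** The input of the Chernoff bounds: [s * Q <= e] lets the slack [e] absorb the quadratic term. *)
Lemma lln_params (e : R) : 0 < e -> exists2 s : R, 0 < s & forall i,
  (laplace mu (dir i s) <= (expR (s * (drift mu 0 i + e)))%:E)%E /\
  (laplace mu (dir i (- s)) <= (expR (s * (- drift mu 0 i + e)))%:E)%E.
Proof.
move=> e0; have [r [Q [r0 Q0 h]]] := mgf_taylor.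
have [s [s0 sr]] : exists s, 0 < s /\ (s <= r /\ s * Q <= e).
  have Q1 : 0 < Q + 1 by lra.
  exists (Num.min r (e / (Q + 1))); rewrite lt_min r0 divr_gt0//; split => //.
  split; first by rewrite ge_min lexx.
  apply: (@le_trans _ _ (e / (Q + 1) * Q)).
    by rewrite ler_wpM2r// ge_min lexx orbT.
  by rewrite mulrAC ler_pdivrMr//; nra.
exists s => // i.
have sQ : s * (s * Q) <= s * e by rewrite ler_wpM2l ?(ltW s0)//; exact: sr.2.
split; (apply: (le_trans (h i _ _)); first by rewrite ?normrN gtr0_norm//; exact: sr.1);
  rewrite lee_fin.
  by apply: le_trans (expR_ge1Dx _); lra.
by apply: le_trans (expR_ge1Dx _); lra.
Qed.

Hypothesis h_pos : forall i, 0 < drift mu 0 i.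

(** Against the drift the transform has slope at most [- m] at the origin; [s * Q <= m / 2] keeps
    half of it. The resulting contraction yields transience and the exit estimates. *)
Lemma neg_params : exists s rho : R, [/\ 0 < s, 0 <= rho < 1 &
  forall i, (laplace mu (dir i (- s)) <= rho%:E)%E].
Proof.
have [r [Q [r0 Q0 h]]] := mgf_taylor.
have [m [m0 m1 hm]] := fin_lower h_pos.
have [s [s0 sr s1 sQ]] : exists s, [/\ 0 < s, s <= r, s <= 1 & s * Q <= m / 2].
  have Q1 : 0 < Q + 1 by lra.
  exists (Num.min (Num.min r 1) (m / 2 / (Q + 1))).
  rewrite !lt_min r0 ltr01 !divr_gt0//; split => //.
  - by rewrite !ge_min lexx.
  - by rewrite !ge_min lexx orbT.
  apply: (@le_trans _ _ (m / 2 / (Q + 1) * Q)).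
    by rewrite ler_wpM2r// ge_min lexx orbT.
  by rewrite mulrAC ler_pdivrMr//; nra.
exists s, (1 - s * (m / 2)); split => //.
  by apply/andP; split; nra.
move=> i; apply: (le_trans (h i _ _)); first by rewrite normrN gtr0_norm.
rewrite lee_fin; have := hm i; nra.
Qed.

(** A convex combination of a point where the transform is at most [rho < 1] and, with small weight
    [l], of an axis point where it is at most [B]. The choice [l * (B - rho) = (1 - rho) / 2] gives
    the value [(1 + rho) / 2]. *)
Lemma exp_params : exists s e rho : R, [/\ 0 < s, 0 < e, 0 <= rho < 1 &
  forall i j, (laplace mu (dir i (- s) + dir j e) <= rho%:E)%E /\
    (laplace mu (dir i (- s) + dir j (- e)) <= rho%:E)%E].
Proof.
have [r [Q [r0 Q0 h]]] := mgf_taylor.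
have [s [rho [s0 /andP[p0 p1] hs]]] := neg_params.
have M0 : 0 <= \sum_i drift mu 0 i by apply: sumr_ge0 => i _; exact: ltW.
pose B := 1 + r * (\sum_i drift mu 0 i) + r ^+ 2 * Q.
have B1 : 1 <= B by rewrite /B; have := sqr_ge0 r; nra.
have hB j : (laplace mu (dir j r) <= B%:E)%E /\ (laplace mu (dir j (- r)) <= B%:E)%E.
  have hj : drift mu 0 j <= \sum_i drift mu 0 i.
    by rewrite (bigD1 j)//= lerDl sumr_ge0// => i _; exact: ltW.
  have := ltW (h_pos j).
  split; (apply: (le_trans (h j _ _)); first by rewrite ?normrN gtr0_norm);
    rewrite lee_fin /B ?sqrrN; nra.
pose l := (1 - rho) / (2 * (B - rho)).
have Bp : 0 < B - rho by lra.
have l0 : 0 < l by rewrite divr_gt0//; lra.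
have lE : 2 * (l * (B - rho)) = 1 - rho by rewrite /l; field; rewrite gt_eqF.
have l1 : l <= 1 / 2 by nra.
exists ((1 - l) * s), (l * r), ((1 + rho) / 2); split.
- by rewrite mulr_gt0//; lra.
- by rewrite mulr_gt0.
- by apply/andP; split; lra.
have e i j (c : R) : dir i (- ((1 - l) * s)) + dir j (l * c) =
    l *: dir j c + (1 - l) *: dir i (- s).
  by rewrite /dir !scalerA mulrN addrC.
have l01 : 0 <= l <= 1 by apply/andP; split; lra.
move=> i j; rewrite -[- (l * r)]mulrN !e.
split.
  apply: le_trans (laplace_convex l01 (hB j).1 (hs i)) _; rewrite lee_fin; lra.
apply: le_trans (laplace_convex l01 (hB j).2 (hs i)) _; rewrite lee_fin; lra.
Qed.

End Mgf.

(** * The free Green function *)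

Section LatticePaths.
Variables (R : realType) (d : nat).
Local Notation V := 'rV[int]_d.

(** [b] is a sign bit, [true] for the negative direction. *)
Definition unitv (i : 'I_d) (b : bool) : V := if b then - delta_mx 0 i else delta_mx 0 i.

Definition norm1 (z : V) : nat := (\sum_i absz (z 0%R i))%N.

Lemma unitvN i b : unitv i (~~ b) = - unitv i b.
Proof. by case: b; rewrite /unitv /= ?opprK. Qed.

Lemma norm1_descent (z : V) k : norm1 z = k.+1 ->
  exists i b, norm1 (z - unitv i b) = k.
Proof.
move=> zk; have [i zi] : exists i, z 0 i != 0.
  apply: contrapT => h; move: zk; rewrite /norm1 big1// => j _.
  by apply/eqP; rewrite absz_eq0; apply: contrapT => /negP zj; apply: h; exists j.
exists i, (z 0 i < 0); apply: succn_inj; rewrite -zk /norm1.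
rewrite (bigD1 i)//= [in RHS](bigD1 i)//= -addSn; congr (_ + _)%N.
  rewrite !mxE /unitv; case: ifP => zi0; rewrite ?mxE !eqxx/=; lia.
apply: eq_bigr => j ji; rewrite !mxE /unitv.
by case: ifP => zi0; rewrite ?mxE (negPf ji) andbF ?oppr0 subr0.
Qed.

(** A shortest lattice path from [0] to [z] stays in the ball of radius [N], and each of its edges
    may be crossed in both directions. *)
Lemma norm1_chain (F : V -> R) (C : R) N : 0 <= C ->
  (forall z i b, (norm1 z <= N)%N -> F (z + unitv i b) <= C * F z) ->
  forall z, (norm1 z <= N)%N ->
    F z <= C ^+ norm1 z * F 0 /\ F 0 <= C ^+ norm1 z * F z.
Proof.
move=> C0 hF z; move: {2}(norm1 z) (erefl (norm1 z)) => k.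
elim: k z => [|k IHk] z zk zN.
  suff -> : z = 0 by rewrite /norm1 big1 ?expr0 ?mul1r// => i _; rewrite mxE.
  apply/rowP => i; rewrite mxE; apply/eqP; rewrite -absz_eq0 -leqn0 -[X in (_ <= X)%N]zk.
  by rewrite /norm1 (bigD1 i)//= leq_addr.
have [i [b zk']] := norm1_descent zk.
have zN' : (norm1 (z - unitv i b) <= N)%N by move: zN; rewrite zk zk' => /ltnW.
have [h1 h2] := IHk _ zk' zN'.
rewrite zk' in h1 h2; rewrite zk exprS; split.
  rewrite -[in leLHS](subrK (unitv i b) z); apply: (le_trans (hF _ i b zN')).
  by rewrite -mulrA ler_wpM2l.
apply: (le_trans h2); rewrite (mulrC C) -mulrA ler_wpM2l ?exprn_ge0//.
by rewrite -unitvN; exact: hF.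
Qed.

End LatticePaths.

Lemma geom_sum_le (R : realType) (rho : R) k : 0 <= rho < 1 ->
  \sum_(0 <= t < k) rho ^+ t <= (1 - rho)^-1.
Proof.
move=> /andP[r0 r1]; rewrite -div1r ler_pdivlMr ?subr_gt0//.
have h := subrX1 rho k; rewrite big_mkord.
have -> : (\sum_(i < k) rho ^+ i) * (1 - rho) = 1 - rho ^+ k.
  have -> : 1 - rho ^+ k = - (rho ^+ k - 1) by rewrite opprB.
  by rewrite h; ring.
by rewrite lerBlDr lerDl exprn_ge0.
Qed.

Section Potential.
Variables (R : realType) (d : nat).
Local Notation V := 'rV[int]_d.
Variables (mu : V -> R) (hmu : prob_mass mu).
Local Notation T := (step mu).

Let tT : tiop T. Proof. exact: tiop_step. Qed.

Lemma bd_iter n f : bd f -> bd (iter n T f).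
Proof. exact: (ti_bd (tiop_iter n tT)). Qed.

Lemma iter_ge0 n f x : bd f -> (forall z, 0 <= f z) -> 0 <= iter n T f x.
Proof. by move=> bf f0; exact: (ti_ge0 (tiop_iter n tT)). Qed.

Lemma iter_exp n f a L C x : 0 <= L -> (laplace mu a <= L%:E)%E -> 0 <= C -> bd f ->
  (forall z, 0 <= f z) -> (forall z, f z <= C * expR (dotp a (intv R z))) ->
  iter n T f x <= C * L ^+ n * expR (dotp a (intv R x)).
Proof.
move=> L0 hL C0 bf f0 fe; elim: n x => [|n IHn] x /=; first by rewrite expr0 mulr1.
rewrite exprSr mulrA; apply: step_exp => //.
- by rewrite mulr_ge0 ?exprn_ge0.
- exact: bd_iter.
- by move=> z; exact: iter_ge0.
Qed.

Definition ind (y : V) : V -> R := fun z => (z == y)%:R.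

Lemma ind_ge0 y z : 0 <= ind y z. Proof. exact: ler0n. Qed.

Lemma bd_indy y : bd (ind y).
Proof. by apply: (@bd_le _ _ 1) => z; rewrite ind_ge0 lern1 leq_b1. Qed.

Definition gpart n y z := \sum_(0 <= t < n) iter t T (ind y) z.

(** The target [y] comes first, so that [gfree y] is a function of the starting point, on which the
    step operator acts. *)
Definition gfree y z := limn (fun n => gpart n y z).

Lemma gpart_ge0 n y z : 0 <= gpart n y z.
Proof. by apply: sumr_ge0 => t _; apply: iter_ge0; [exact: bd_indy|exact: ind_ge0]. Qed.

Lemma gpartSr n y z : gpart n.+1 y z = gpart n y z + iter n T (ind y) z.
Proof. by rewrite /gpart big_nat_recr. Qed.

Lemma bd_gpart n y : bd (gpart n y).
Proof.
elim: n => [|n [C hC]].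
  by exists 0 => z; rewrite /gpart big_nil normr0.
have [C' hC'] := bd_iter n (bd_indy y).
exists (C + C') => z; rewrite gpartSr (le_trans (ler_normD _ _))//.
by rewrite lerD.
Qed.

Lemma gpartS n y z : gpart n.+1 y z = ind y z + T (gpart n y) z.
Proof.
elim: n z => [|n IHn] z.
  rewrite gpartSr /gpart big_nil add0r /=.
  rewrite (_ : (fun z => _) = fun=> 0); last by apply/funext => u; rewrite big_nil.
  by rewrite step_cst// addr0.
rewrite gpartSr IHn -addrA; congr (_ + _).
rewrite iterS (_ : gpart n.+1 y = fun z => gpart n y z + iter n T (ind y) z).
  by rewrite stepD//; [exact: bd_gpart|apply: bd_iter; exact: bd_indy].
by apply/funext => u; rewrite gpartSr.
Qed.

Variables (a : 'rV[R]_d) (rho : R) (rho01 : 0 <= rho < 1)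
  (ha : (laplace mu a <= rho%:E)%E).

Let m := (1 - rho)^-1.

(* Maximum principle: the bound at [z = y] propagates to every [z]. *)
Lemma gpart_le n y z : 0 <= gpart n y z <= m.
Proof.
rewrite gpart_ge0/=; have /andP[r0 r1] := rho01.
have diag k : gpart k y y <= m.
  apply: (@le_trans _ _ (\sum_(0 <= t < k) rho ^+ t)).
    apply: ler_sum => t _.
    rewrite [leRHS](_ : _ = expR (- dotp a (intv R y)) * rho ^+ t * expR (dotp a (intv R y))).
      apply: iter_exp => //; first exact: bd_indy.
      move=> u; rewrite /ind; case: eqVneq => [->|_].
        by rewrite -expRD addNr expR0.
      by rewrite mulr_ge0// expR_ge0.
    by rewrite mulrAC -expRD addNr expR0 mul1r.
  exact: geom_sum_le.
elim: n z => [|n IHn] z.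
  by rewrite /gpart big_nil invr_ge0 subr_ge0 ltW.
have [->|zy] := eqVneq z y; first exact: diag.
rewrite gpartS /ind (negPf zy) add0r.
rewrite -[leRHS](congr1 (fun u => u z) (step_cst hmu m)).
by apply: step_le => //; [exact: bd_gpart|exact: bd_cst].
Qed.

Lemma gpart_nd y z : nondecreasing_seq (fun n => gpart n y z).
Proof.
apply/nondecreasing_seqP => n; rewrite gpartSr lerDl.
by apply: iter_ge0; [exact: bd_indy|exact: ind_ge0].
Qed.

Lemma gpart_cvg y z : gpart n y z @[n --> \oo] --> gfree y z.
Proof.
apply: nondecreasing_is_cvgn; first exact: gpart_nd.
by exists m => _ [n _ <-]; have /andP[] := gpart_le n y z.
Qed.

Lemma gpart_gfree n y z : gpart n y z <= gfree y z.
Proof. by apply: nondecreasing_cvgn_le; [exact: gpart_nd|exact: gpart_cvg]. Qed.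

Lemma gfree_le y z : 0 <= gfree y z <= m.
Proof.
rewrite (le_trans (gpart_ge0 0 y z) (gpart_gfree _ _ _))/=.
apply: (cvgr_to_le (@gpart_cvg y z)); apply: nearW => n.
by have /andP[] := gpart_le n y z.
Qed.

Lemma bd_gfree y : bd (gfree y). Proof. exact: bd_le (gfree_le y). Qed.

Lemma gfreeE y z : gfree y z = ind y z + T (gfree y) z.
Proof.
have h : gpart n.+1 y z @[n --> \oo] --> gfree y z.
  by rewrite (@cvg_shiftS _ (fun n => gpart n y z)); exact: gpart_cvg.
rewrite -(cvg_lim (@Rhausdorff R) h); apply: (cvg_lim (@Rhausdorff R)).
under eq_fun do rewrite gpartS.
apply: cvgD; first exact: cvg_cst.
apply: (step_cvg hmu (C := m)); last exact: gpart_cvg.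
by move=> n u; have /andP[h1 h2] := gpart_le n y u; rewrite ger0_norm.
Qed.

(** The iterate of the potential is the tail of the Green series: it lies below the potential and
    tends to [0]. *)
Lemma gfree_iter n y z : gfree y z = gpart n y z + iter n T (gfree y) z.
Proof.
elim: n z => [|n IHn] z; first by rewrite /gpart big_nil add0r.
rewrite gfreeE gpartS -addrA; congr (_ + _); rewrite iterS.
have := stepD hmu (bd_gpart n y) (bd_iter n (bd_gfree y)).
move=> /(congr1 (fun u => u z)) <-.
by congr (T _ z); apply/funext => u; exact: IHn.
Qed.

Lemma iter_gfree_le n y z : iter n T (gfree y) z <= gfree y z.
Proof. by rewrite (gfree_iter n y z) lerDr gpart_ge0. Qed.

Lemma iter_gfree_cvg y z : iter n T (gfree y) z @[n --> \oo] --> 0.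
Proof.
rewrite (_ : (fun n => _) = fun n => gfree y z - gpart n y z); last first.
  by apply/funext => n; rewrite (gfree_iter n) addrAC subrr add0r.
rewrite -(subrr (gfree y z)); apply: cvgB; [exact: cvg_cst|exact: gpart_cvg].
Qed.

Lemma gfree_diag y : 1 <= gfree y y.
Proof.
apply: le_trans (gpart_gfree 1 y y).
by rewrite gpartSr /gpart big_nil add0r /= /ind eqxx.
Qed.

Lemma path_iter k (z : nat -> V) : (forall j, (1 <= j <= k)%N -> 0 < mu (z j - z j.-1)) ->
  exists2 p, 0 < p & forall f, bd f -> (forall u, 0 <= f u) -> forall v,
    p * f (v + z k) <= iter k T f (v + z 0%N).
Proof.
elim: k z => [|k IHk] z hz; first by exists 1 => // f _ _ v; rewrite mul1r.
have [|p p0 hp] := IHk (fun j => z j.+1).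
  by move=> [//|j] /andP[_ jk]; apply: (hz j.+2); rewrite /= ltnS.
have m1 := hz 1%N isT.
exists (mu (z 1%N - z 0%N) * p); first by rewrite mulr_gt0.
move=> f bf f0 v; rewrite iterS.
have h := step_ge_atom hmu (v + z 0%N) (z 1%N - z 0%N) (bd_iter k bf)
  (fun u => iter_ge0 k u bf f0).
apply: le_trans h; rewrite -mulrA; apply: ler_wpM2l; first exact: ltW.
by rewrite -addrA (addrC (z 0%N)) subrK; exact: hp.
Qed.

Hypothesis h_irr : communicates mu (orthant_on finset.set0).

(** For the empty index set [orthant_on] is the whole lattice; translation invariance makes [k] and
    [p] independent of the starting point [v]. *)
Lemma reach w : exists k p, 0 < p /\ forall f, bd f -> (forall u, 0 <= f u) -> forall v,
    p * f (v + w) <= iter k T f v.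
Proof.
have [||k [z [z0 zk _ hz]]] := @h_irr 0 w.
- by move=> i; rewrite inE.
- by move=> i; rewrite inE.
have [p p0 hp] := path_iter hz; exists k, p; split => // f bf f0 v.
by have := hp f bf f0 v; rewrite z0 zk addr0.
Qed.

(** A path of positive weight [p] and superharmonicity give [p * g (z + w) <= T^k g z <= g z];
    finitely many directions share one constant. *)
Lemma harnack : exists2 C, 1 <= C & forall y z i b,
  gfree y (z + unitv i b) <= C * gfree y z.
Proof.
have h (ib : 'I_d * bool) : exists p, 0 < p /\
    forall y z, p * gfree y (z + unitv ib.1 ib.2) <= gfree y z.
  have [k [p [p0 hp]]] := reach (unitv ib.1 ib.2); exists p; split => // y z.
  apply: le_trans (iter_gfree_le k y z); apply: hp; first exact: bd_gfree.
  by move=> u; have /andP[] := gfree_le y u.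
have [P hP] := choice h.
have [q [q0 q1 hq]] := fin_lower (fun ib => (hP ib).1).
exists q^-1; first by rewrite invf_ge1.
move=> y z i b; rewrite ler_pdivlMl//.
apply: le_trans ((hP (i, b)).2 y z); rewrite ler_wpM2r ?hq//.
by have /andP[] := gfree_le y (z + unitv i b).
Qed.

End Potential.

(** * Lower bound and ratio limit for the free Green function *)

Lemma exp_large (R : realType) (c C : R) : 0 < c ->
  exists t0, forall t, (t0 <= t)%N -> C <= expR (c * t%:R).
Proof.
move=> c0; exists (Num.truncn (`|C| / c)).+1 => t ht.
apply: le_trans (expR_ge1Dx _).
have h : `|C| / c < t%:R.
  apply: lt_le_trans (_ : (Num.truncn (`|C| / c)).+1%:R <= _); last by rewrite ler_nat.
  exact: truncnS_gt.
rewrite ltr_pdivrMr// in h; have := ler_norm C; nra.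
Qed.

Lemma expR_nat (R : realType) (x : R) n : expR x ^+ n = expR (x * n%:R).
Proof. by rewrite mulrC expRM_natl. Qed.

Section LocalEstimates.
Variables (R : realType) (d : nat).
Local Notation V := 'rV[int]_d.
Variables (mu : V -> R) (hmu : prob_mass mu).
Local Notation T := (step mu).
Local Notation M := (drift mu 0).
Hypothesis h_exp : set_nbhs (sublevel1 mu) [set a | (laplace mu a < +oo)%E].
Hypothesis h_irr : communicates mu (orthant_on finset.set0).
Variables (a : 'rV[R]_d) (rho : R) (rho01 : 0 <= rho < 1)
  (ha : (laplace mu a <= rho%:E)%E).
Local Notation g := (gfree mu).

Let tT : tiop T. Proof. exact: tiop_step. Qed.

Lemma tiop_sum O (I : Type) (s : seq I) (f : I -> V -> R) x : tiop O -> (forall i, bd (f i)) ->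
  bd (fun z => \sum_(i <- s) f i z) /\
  O (fun z => \sum_(i <- s) f i z) x = \sum_(i <- s) O (f i) x.
Proof.
move=> tO bf; elim: s => [|i s [IH1 IH2]].
  rewrite big_nil (_ : (fun z => _) = fun z => 0 * 0); last first.
    by apply/funext => z; rewrite big_nil mulr0.
  split; first exact: bd_cst.
  by rewrite (tiZ tO 0 (bd_cst d 0)) mul0r.
rewrite (_ : (fun z => _) = fun z => f i z + \sum_(j <- s) f j z); last first.
  by apply/funext => z; rewrite big_cons.
by split; [exact: bdD|rewrite (tiD tO)// IH2 big_cons].
Qed.

Lemma iter_cst n c : iter n T (fun=> c) = fun=> c.
Proof. by elim: n => //= n ->; exact: step_cst. Qed.

Definition nearM (e : R) t (z : V) : bool :=
  [forall i, `|(z 0 i)%:~R - t%:R * M i| <= e * t%:R].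

(** Chernoff bounds for the [2 d] one-sided deviations. Half of [e] is the slack in [lln_params],
    the other half the decay rate; [t0] makes the total at most [1 / 2]. *)
Lemma lln e : 0 < e -> exists t0, forall t, (t0 <= t)%N ->
  1 / 2 <= iter t T (fun z => (nearM e t z)%:R) 0.
Proof.
move=> e0; have [s s0 hs] := lln_params hmu h_exp (e := e / 2) ltac:(lra).
have se : 0 < s * (e / 2) by rewrite mulr_gt0//; lra.
have [t0 ht0] := exp_large (4 * d%:R) se.
exists t0 => t /ht0 ht.
pose fp i (z : V) : R := (e * t%:R < (z 0 i)%:~R - t%:R * M i)%R%:R.
pose fm i (z : V) : R := ((z 0 i)%:~R - t%:R * M i < - (e * t%:R))%R%:R.
have bp (p : V -> bool) : bd (fun z => (p z)%:R : R).
  by apply: (@bd_le _ _ 1) => z; rewrite ler0n lern1 leq_b1.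
have dot0 (b : 'rV[R]_d) : dotp b (intv R 0) = 0.
  by rewrite /dotp big1// => i _; rewrite !mxE mulr0.
have hp i : iter t T (fp i) 0 <= expR (- (s * (e / 2) * t%:R)).
  have [h _] := hs i.
  rewrite [leRHS](_ : _ = expR (- (s * (M i + e) * t%:R)) *
    expR (s * (M i + e / 2)) ^+ t * expR (dotp (dir i s) (intv R 0))); last first.
    by rewrite dot0 expR0 mulr1 expR_nat -expRD; congr expR; field.
  apply: iter_exp => //; rewrite ?expR_ge0//; first exact: bp.
  move=> z; rewrite /fp dotp_dir -expRD; case: ltP => hz; last exact: expR_ge0.
  rewrite -[leLHS]expR0 ler_expR; nra.
have hm i : iter t T (fm i) 0 <= expR (- (s * (e / 2) * t%:R)).
  have [_ h] := hs i.
  rewrite [leRHS](_ : _ = expR (- (s * (- M i + e) * t%:R)) *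
    expR (s * (- M i + e / 2)) ^+ t * expR (dotp (dir i (- s)) (intv R 0))); last first.
    by rewrite dot0 expR0 mulr1 expR_nat -expRD; congr expR; field.
  apply: iter_exp => //; rewrite ?expR_ge0//; first exact: bp.
  move=> z; rewrite /fm dotp_dir -expRD; case: ltP => hz; last exact: expR_ge0.
  rewrite -[leLHS]expR0 ler_expR; nra.
have tO := tiop_iter t tT.
have [bP eP] := tiop_sum (index_enum 'I_d) 0 tO (fun i => bp (fun z => _) : bd (fp i)).
have [bM eM] := tiop_sum (index_enum 'I_d) 0 tO (fun i => bp (fun z => _) : bd (fm i)).
have bN : bd (fun z => (nearM e t z)%:R : R) by exact: bp.
have h1 : iter t T (fun=> 1) 0 <=
  iter t T (fun z => (nearM e t z)%:R + (\sum_i fp i z + \sum_i fm i z)) 0.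
  apply: (tiop_le 0 tO (bd_cst d 1)); first by apply: bdD => //; exact: bdD.
  move=> z; have p0 : 0 <= \sum_i fp i z by apply: sumr_ge0 => i _; rewrite ler0n.
  have m0 : 0 <= \sum_i fm i z by apply: sumr_ge0 => i _; rewrite ler0n.
  case: (boolP (nearM e t z)) => [_|]; first by rewrite lerDl addr_ge0.
  rewrite mulr0n add0r negb_forall => /existsP[i]; rewrite -ltNge lter_normr => /orP[hi|hi].
    suff : 1 <= \sum_i fp i z by lra.
    rewrite (bigD1 i)//= {1}/fp hi lerDl sumr_ge0// => j _; exact: ler0n.
  suff : 1 <= \sum_i fm i z by lra.
  rewrite (bigD1 i)//= {1}/fm ltrNr hi lerDl sumr_ge0// => j _; exact: ler0n.
rewrite iter_cst (tiD tO bN (bdD bP bM)) (tiD tO bP bM) eP eM in h1.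
have sumle (f : 'I_d -> V -> R) : (forall i, iter t T (f i) 0 <= expR (- (s * (e / 2) * t%:R))) ->
    \sum_i iter t T (f i) 0 <= d%:R * expR (- (s * (e / 2) * t%:R)).
  move=> h; apply: le_trans (ler_sum _ (fun i _ => h i)) _.
  by rewrite sumr_const card_ord -[leLHS]mulr_natl.
have h2 := sumle _ hp; have h3 := sumle _ hm.
have h4 : 4 * d%:R * expR (- (s * (e / 2) * t%:R)) <= 1.
  by rewrite expRN ler_pdivrMr ?expR_gt0// mul1r.
move: h1; rewrite /=; lra.
Qed.

Lemma harnack_exp : exists2 l : R, 0 <= l & forall y z,
  g y y <= expR (l * (norm1 (z - y))%:R) * g y z /\
  g y 0 <= expR (l * (norm1 z)%:R) * g y z.
Proof.
have [C C1 hC] := harnack hmu rho01 ha h_irr.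
exists (ln C); first exact: ln_ge0.
have C0 : 0 < C by lra.
move=> y z; rewrite -!expR_nat lnK ?posrE//.
have h y0 : forall u, (norm1 u <= norm1 (z - y0))%N ->
    g y (y0 + u) <= C ^+ norm1 u * g y (y0 + 0) /\ g y (y0 + 0) <= C ^+ norm1 u * g y (y0 + u).
  apply: (norm1_chain (F := fun u => g y (y0 + u)) (ltW C0)) => u i b _.
  by rewrite addrA.
have [_ h2] := h y (z - y) (leqnn _).
have [|_ h3] := h 0 z; first by rewrite subr0.
by rewrite addr0 (addrC y) subrK in h2; rewrite !add0r in h3.
Qed.

Lemma norm1_near e t y z : nearM e t y -> nearM e t z ->
  (norm1 (z - y))%:R <= d%:R * (2 * e * t%:R) :> R.
Proof.
move=> /forallP hy /forallP hz; rewrite /norm1 natr_sum.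
apply: (@le_trans _ _ (\sum_(i < d) (2 * e * t%:R))).
  apply: ler_sum => i _; rewrite natr_absz !mxE intr_norm intrB.
  have -> : (z 0 i)%:~R - (y 0 i)%:~R = ((z 0 i)%:~R - t%:R * M i) - ((y 0 i)%:~R - t%:R * M i) :> R.
    by ring.
  apply: le_trans (ler_normB _ _) _; have := hy i; have := hz i; lra.
by rewrite sumr_const card_ord -[leLHS]mulr_natl.
Qed.

(** With probability at least [1 / 2] the walk is near [t M] at time [t], hence within [2 d e t] of
    [y], where Harnack and [g y y >= 1] give [exp (- D t / 2)]. The other half of [D] pays for the
    factor [1 / 2]. *)
Lemma gfree_lower D : 0 < D -> exists e : R, 0 < e /\ exists t0, forall t, (t0 <= t)%N ->
  forall y, nearM e t y -> expR (- (D * t%:R)) <= g y 0.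
Proof.
move=> D0; have [l l0 hl] := harnack_exp.
pose e := D / (4 * (l + 1) * (d%:R + 1)).
have d0 : 0 <= d%:R :> R by exact: ler0n.
have k0 : 0 < 4 * (l + 1) * (d%:R + 1) by rewrite !mulr_gt0//; lra.
have e0 : 0 < e by rewrite divr_gt0.
have eE : e * (4 * (l + 1) * (d%:R + 1)) = D by rewrite /e divfK// gt_eqF.
have led : l * (d%:R * (2 * e)) <= D / 2.
  have -> : D / 2 = 2 * e * ((l + 1) * (d%:R + 1)) by rewrite -eE; field.
  have -> : l * (d%:R * (2 * e)) = 2 * e * (l * d%:R) by ring.
  by rewrite ler_wpM2l//; nra.
have [t1 h1] := lln e0.
have D2 : 0 < D / 2 by lra.
have [t2 h2] := exp_large 2 D2.
exists e; split => //; exists (maxn t1 t2) => t; rewrite geq_max => /andP[/h1 ht1 /h2 ht2].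
move=> y hy; apply: le_trans (iter_gfree_le hmu rho01 ha t y 0).
pose k : R := expR (- (D / 2 * t%:R)).
have k00 : 0 <= k by exact: expR_ge0.
have tO := tiop_iter t tT.
have bp : bd (fun z => (nearM e t z)%:R : R).
  by apply: (@bd_le _ _ 1) => z; rewrite ler0n lern1 leq_b1.
have h : iter t T (fun z => k * (nearM e t z)%:R) 0 <= iter t T (g y) 0.
  apply: (tiop_le 0 tO); [exact: bdZ|exact: (bd_gfree hmu rho01 ha)|] => z.
  case: (boolP (nearM e t z)) => hz; last first.
    by rewrite mulr0; have /andP[] := gfree_le hmu rho01 ha y z.
  rewrite mulr1; have [h _] := hl y z.
  have g1 := gfree_diag hmu rho01 ha y.
  have hn := norm1_near hy hz.
  rewrite /k expRN -div1r ler_pdivrMr ?expR_gt0// mulrC.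
  apply: (le_trans g1); apply: (le_trans h); rewrite ler_wpM2r//.
    by have /andP[] := gfree_le hmu rho01 ha y z.
  rewrite ler_expR; apply: le_trans (ler_wpM2l l0 hn) _.
  have -> : l * (d%:R * (2 * e * t%:R)) = l * (d%:R * (2 * e)) * t%:R by ring.
  by rewrite ler_wpM2r.
apply: le_trans h; rewrite (tiZ tO)//.
have -> : - (D * t%:R) = - (D / 2 * t%:R) - D / 2 * t%:R by field.
rewrite expRD ler_wpM2l//; apply: le_trans ht1.
by rewrite expRN div1r lef_pV2 ?posrE ?expR_gt0.
Qed.

End LocalEstimates.

(** * Comparison of the free Green function at neighbouring points *)

Lemma rate_le (R : realType) (x k t r n : R) : 0 <= x -> 0 <= t -> r <= x * k ->
  k * t <= n + 1 -> - x * n <= x + - (r * t).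
Proof.
move=> x0 t0 h1 h2; have := ler_wpM2r t0 h1; have := ler_wpM2l x0 h2; lra.
Qed.

Lemma unitv_le1 (R : realType) d (i : 'I_d) b j : (unitv i b 0 j)%:~R <= 1 :> R.
Proof.
have h : unitv i b 0 j <= 1.
  by case: b; rewrite /unitv !mxE eqxx/=; case: eqP.
by rewrite -(ler_int R) in h.
Qed.

Section RatioLimit.
Variables (R : realType) (d : nat).
Local Notation V := 'rV[int]_d.
Variables (mu : V -> R) (hmu : prob_mass mu).
Local Notation T := (step mu).
Local Notation Z := (lazy (step mu)).
Local Notation M := (drift mu 0).
Hypothesis h_exp : set_nbhs (sublevel1 mu) [set a | (laplace mu a < +oo)%E].
Hypothesis h_irr : communicates mu (orthant_on finset.set0).
Variables (a : 'rV[R]_d) (rho : R) (rho01 : 0 <= rho < 1)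
  (ha : (laplace mu a <= rho%:E)%E).
Local Notation g := (gfree mu).

Let tT : tiop T. Proof. exact: tiop_step. Qed.
Let tZ : tiop Z. Proof. exact: tiop_lazy. Qed.

Lemma lazy_cst c : Z (fun=> c) = fun=> c.
Proof. by apply/funext => x; rewrite /lazy step_cst//; field. Qed.

(** The extreme terms in the expansion of the [k]-th power of [(1 + T) / 2] are [2^-k] times the
    identity and [2^-k T^k]. *)
Lemma lazy_ge k f x : bd f -> (forall z, 0 <= f z) ->
  2^-1 ^+ k * f x <= iter k Z f x /\ 2^-1 ^+ k * iter k T f x <= iter k Z f x.
Proof.
move=> bf f0; elim: k x => [|k IHk] x; first by rewrite !expr0 !mul1r.
rewrite !iterS exprS.
have bZ : bd (iter k Z f) by exact: (ti_bd (tiop_iter k tZ)).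
have bT : bd (iter k T f) by exact: (ti_bd (tiop_iter k tT)).
have Z0 z : 0 <= iter k Z f z by exact: (ti_ge0 (tiop_iter k tZ)).
have h1 : 0 <= T (iter k Z f) x by exact: (ti_ge0 tT).
have h2 : 2^-1 ^+ k * T (iter k T f) x <= T (iter k Z f) x.
  have := congr1 (fun u => u x) (tiZ tT (2^-1 ^+ k) bT) => /= <-.
  apply: (tiop_le x tT) => //; first exact: bdZ.
  by move=> z; have [] := IHk z.
have [h3 _] := IHk x; have h4 := Z0 x.
by rewrite /lazy; split; lra.
Qed.

(** The lazy factor is [(1 + L) / 2], which is at most [L] because [1 <= L]. *)
Lemma lazy_exp n f b L C x : 1 <= L -> (laplace mu b <= L%:E)%E -> 0 <= C -> bd f ->
  (forall z, 0 <= f z) -> (forall z, f z <= C * expR (dotp b (intv R z))) ->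
  iter n Z f x <= C * L ^+ n * expR (dotp b (intv R x)).
Proof.
move=> L1 hL C0 bf f0 fe; have L0 : 0 <= L by lra.
elim: n x => [|n IHn] x; first by rewrite expr0 mulr1.
rewrite iterS exprSr /lazy.
have h : T (iter n Z f) x <= C * L ^+ n * L * expR (dotp b (intv R x)).
  apply: step_exp => //; first by rewrite mulr_ge0 ?exprn_ge0.
    exact: (ti_bd (tiop_iter n tZ)).
  by move=> z; exact: (ti_ge0 (tiop_iter n tZ)).
have h2 : C * L ^+ n * expR (dotp b (intv R x)) <= C * L ^+ n * L * expR (dotp b (intv R x)).
  by rewrite ler_wpM2r ?expR_ge0// ler_peMr// mulr_ge0 ?exprn_ge0.
have := IHn x; lra.
Qed.

(** The equation [g = ind + T g] is equivalent to [g = ind / 2 + Z g]: the lazy Green function is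
    [2 g]. *)
Lemma gfree_lazy n y z :
  g y z = 2^-1 * (\sum_(0 <= t < n) iter t Z (ind R y) z) + iter n Z (g y) z.
Proof.
have bg := bd_gfree hmu rho01 ha y.
elim: n => [|n IHn]; first by rewrite big_nil mulr0 add0r.
rewrite IHn big_nat_recr//= mulrDr -addrA; congr (_ + _).
have gE : g y = fun z => 2^-1 * ind R y z + Z (g y) z.
  by apply/funext => u; rewrite /lazy; have := gfreeE hmu rho01 ha y u; lra.
have tO := tiop_iter n tZ; rewrite -iterS iterSr [in LHS]gE.
rewrite (tiD tO); [|by apply: bdZ; exact: bd_indy|exact: (ti_bd tZ)].
by rewrite (tiZ tO)//; exact: bd_indy.
Qed.

Variable i0 : 'I_d.
Hypothesis h_pos : 0 < M i0.

(* Laziness removes the periodicity of the walk: it makes some power of the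
   kernel charge both [0] and the unit vector.  The first [n * k] terms of the
   Green series, with [n] a small multiple of [t], are exponentially small since
   the walk has to travel a distance of order [t]. *)
Lemma ratio_step i b (e : R) : 0 < e -> exists c C : R, [/\ 0 < c, 0 <= C &
  forall t (y z : V), M i0 / 2 * t%:R <= (y 0 i0)%:~R - (z 0 i0)%:~R ->
    g y (z + unitv i b) <= (1 + e) * g y z + C * expR (- (c * t%:R))].
Proof.
move=> e0; set w := unitv i b.
have [k [p [p0 hp]]] := reach hmu h_irr w.
have p1 : p <= 1.
  have := hp (fun=> 1) (bd_cst d 1) (fun=> ler01) 0.
  by rewrite iter_cst// mulr1.
(* Each of the two lower bounds for [nu] is used with weight [1 / 2]; [p <= 1] lets both have the
   same coefficient. *)
pose c := 2^-1 * (2^-1 ^+ k * p).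
have k0 : 0 < 2^-1 ^+ k :> R by rewrite exprn_gt0.
have k1 : 2^-1 ^+ k <= 1 :> R by rewrite exprn_ile1//; lra.
have c0 : 0 < c by rewrite !mulr_gt0.
have c1 : 2 * c <= 1.
  have -> : 2 * c = 2^-1 ^+ k * p by rewrite /c; field.
  by apply: mulr_ile1 => //; exact: ltW.
pose nu := iter k Z.
have tnu : tiop nu by exact: tiop_iter.
have nu1 r : nu (fun=> r) = fun=> r.
  by rewrite /nu; elim: k {hp k0 k1 c c0 c1 nu tnu} => //= k ->; exact: lazy_cst.
have nu_ge f : bd f -> (forall z, 0 <= f z) ->
    forall x, c * f x + c * f (x + w) <= nu f x.
  move=> bf f0 x; have [h1 h2] := lazy_ge k x bf f0.
  have h3 := ler_wpM2l (ltW k0) (hp f bf f0 x).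
  have h4 : 2^-1 ^+ k * p * f x <= 2^-1 ^+ k * f x.
    by rewrite ler_wpM2r// ler_piMr// ltW.
  by rewrite /c /nu; lra.
have [s [s0 /andP[q0 q1]]] := ratio_rate c0 c1 e0.
set q := c * _ + _ + _ in q0 q1.
pose chi := 1 - q.
have chi0 : 0 < chi by rewrite /chi; lra.
have qchi : q <= expR (- chi) by have := expR_ge1Dx (- chi); rewrite /chi; lra.
have [th th0 hth] := lln_params hmu h_exp (e := 1) ltac:(lra).
have [K KE] : exists K, K = th * (M i0 + 1) by eexists.
have K0 : 0 < K by rewrite KE mulr_gt0// addr_gt0.
(* About [kap * t] powers of [nu] are used. Their exponential cost [(K + 1) n k] is at most
   [th M t / 4], half of the gain [th M t / 2] from the distance; the [1] in [K + 1] pays for the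
   number [n k] of terms. *)
pose kap := th * M i0 / (4 * ((K + 1) * (k%:R + 1))).
have kr0 : 0 <= k%:R :> R by exact: ler0n.
have Kk0 : 0 < (K + 1) * (k%:R + 1) by rewrite mulr_gt0//; lra.
have kap0 : 0 < kap by apply: divr_gt0; apply: mulr_gt0.
have kapE : (K + 1) * (k%:R + 1) * kap = th * M i0 / 4.
  rewrite /kap; move: Kk0; set A := (K + 1) * _ => A0.
  by field; rewrite gt_eqF.
clearbody kap chi.
pose m := (1 - rho)^-1.
have rho1 : 0 < 1 - rho by have /andP[] := rho01; lra.
have m0 : 0 < m by rewrite invr_gt0.
(* [chi * kap] is the decay rate of the unpaired words, [th * M i0 / 4] that of the initial terms of
   the series. *)
have [r [r0 r1 r2]] : exists r : R, [/\ 0 < r, r <= chi * kap & r <= th * M i0 / 4].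
  exists (Num.min (chi * kap) (th * M i0 / 4)); split.
  - rewrite lt_min; apply/andP; split; first exact: mulr_gt0.
    by apply: divr_gt0 => //; exact: mulr_gt0.
  - by rewrite ge_min lexx.
  - by rewrite ge_min lexx orbT.
exists r, (expR s * m * expR chi + expR th); split => //.
  by apply: addr_ge0; rewrite ?mulr_ge0 ?expR_ge0// (ltW m0).
move=> t y z hyz.
pose n := Num.truncn (kap * t%:R).
have t0 : 0 <= t%:R :> R by exact: ler0n.
have /andP[n1 n2] : n%:R <= kap * t%:R < n.+1%:R.
  by apply: truncn_itv; rewrite mulr_ge0// ltW.
have iterE f : iter (n * k)%N Z f = iter n nu f.
  rewrite /nu; elim: n {n1 n2} => // n IHn; by rewrite mulSn iterD IHn.
have gm := gfree_le hmu rho01 ha y.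
have h1 := ratio_shift tnu nu1 (ltW c0) nu_ge gm n z e0 (ltW s0).
rewrite -/q -/m -iterE in h1.
have h2 : expR s * q ^+ n * m <= expR s * m * expR chi * expR (- (r * t%:R)).
  rewrite mulrAC -[leRHS]mulrA ler_wpM2l ?mulr_ge0 ?expR_ge0 ?(ltW m0)//.
  apply: (@le_trans _ _ (expR (- chi) ^+ n)); first by rewrite lerXn2r ?nnegrE ?expR_ge0.
  rewrite expR_nat -expRD ler_expR.
  have hn : kap * t%:R <= n%:R + 1 by rewrite -natr1 in n2; exact: ltW.
  exact: rate_le (ltW chi0) t0 r1 hn.
pose Sy := \sum_(0 <= t < n * k) iter t Z (ind R y) (z + w).
have wle : (w 0 i0)%:~R <= 1 :> R by exact: unitv_le1.
have h3 : Sy <= expR th * expR (- (r * t%:R)).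
  have [hL _] := hth i0.
  have hS : Sy <= \sum_(0 <= j < n * k) expR (K * (n * k)%:R - th * (y 0 i0)%:~R + th * ((z 0 i0)%:~R + 1)).
    rewrite /Sy !big_nat; apply: ler_sum => j /andP[_ jn].
    have hj : iter j Z (ind R y) (z + w) <= expR (- (th * (y 0 i0)%:~R)) * expR K ^+ j *
        expR (dotp (dir i0 th) (intv R (z + w))).
      apply: lazy_exp => //.
      - by apply: le_trans (expR_ge1Dx K); rewrite lerDl ltW.
      - by rewrite KE.
      - exact: bd_indy.
      - move=> u; rewrite /ind dotp_dir; case: eqVneq => [->|_].
          by rewrite -expRD addNr expR0.
        by rewrite mulr_ge0// expR_ge0.
    apply: (le_trans hj).
    rewrite dotp_dir expR_nat -!expRD ler_expR mxE intrD.
    have : K * j%:R <= K * (n * k)%:R by rewrite ler_wpM2l ?(ltW K0)// ler_nat ltnW.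
    have := ler_wpM2l (ltW th0) wle; lra.
  apply: (le_trans hS); rewrite sumr_const_nat subn0 -[leLHS]mulr_natl.
  have hN : (n * k)%:R <= expR (n * k)%:R :> R by have := expR_ge1Dx ((n * k)%:R : R); lra.
  apply: (@le_trans _ _ (expR (n * k)%:R * expR (K * (n * k)%:R - th * (y 0 i0)%:~R + th * ((z 0 i0)%:~R + 1)))).
    by rewrite ler_wpM2r// expR_ge0.
  rewrite -!expRD ler_expR.
  have hk : (K + 1) * (n * k)%:R <= th * M i0 / 4 * t%:R.
    rewrite -kapE natrM.
    have h : n%:R * k%:R <= kap * t%:R * (k%:R + 1).
      by apply: ler_pM => //; lra.
    have := ler_wpM2l (_ : 0 <= K + 1) h => /(_ ltac:(lra)); lra.
  have := ler_wpM2r t0 r2; have := ler_wpM2l (ltW th0) hyz; lra.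
have S0 : 0 <= Sy.
  apply: sumr_ge0 => j _; apply: (ti_ge0 (tiop_iter j tZ)); first exact: bd_indy.
  by move=> u; exact: ind_ge0.
have h4 : iter (n * k) Z (g y) z <= g y z.
  rewrite [leRHS](gfree_lazy (n * k)) lerDr mulr_ge0//.
  apply: sumr_ge0 => j _; apply: (ti_ge0 (tiop_iter j tZ)); first exact: bd_indy.
  by move=> u; exact: ind_ge0.
have h5 := ler_wpM2l (_ : 0 <= 1 + e) h4.
rewrite (gfree_lazy (n * k) y (z + w)) -/Sy mulrDl.
have := h5 ltac:(lra); lra.
Qed.

End RatioLimit.

(** From [exp x - 1 <= x exp x]: one half of the exponent [e * n] bounds the linear factor, the
    other half bounds [exp x]. The rate on the left is the loss per lattice step allowed in
    [gfree_ratio]. *)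
Lemma expR_growth (R : realType) (th e n : R) : 0 < th -> 0 < e -> 0 <= n ->
  expR (Num.min th 1 * e / 2 * n) - 1 <= th * expR (e * n).
Proof.
move=> th0 e0 n0; set u := Num.min th 1.
have u0 : 0 < u by rewrite lt_min th0 ltr01.
have u1 : u <= 1 by rewrite ge_min lexx orbT.
have uth : u <= th by rewrite ge_min lexx.
clearbody u; set x := u * e / 2 * n; set v := e * n / 2.
have v0 : 0 <= v by rewrite /v divr_ge0// mulr_ge0// ltW.
have xE : x = u * v by rewrite /x /v; field.
have x0 : 0 <= x by rewrite xE mulr_ge0// ltW.
have h1 : expR x - 1 <= x * expR x.
  have := expR_ge1Dx (- x); have := expR_gt0 x.
  have : expR (- x) * expR x = 1 by rewrite expRN mulVf// gt_eqF ?expR_gt0.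
  nra.
have h2 : expR x <= expR v by rewrite ler_expR xE ler_piMl.
have h3 : x <= th * expR v.
  rewrite xE; apply: ler_pM => //; first exact: ltW.
  by have := expR_ge1Dx v; lra.
have -> : e * n = v + v by rewrite /v; field.
rewrite expRD mulrA; apply: (le_trans h1); apply: ler_pM => //; exact: expR_ge0.
Qed.

(** * The Green function against its value at the origin, in the weighted norm *)

Section KeyEstimate.
Variables (R : realType) (d : nat).
Local Notation V := 'rV[int]_d.
Variables (mu : V -> R) (hmu : prob_mass mu).
Local Notation M := (drift mu 0).
Hypothesis h_exp : set_nbhs (sublevel1 mu) [set a | (laplace mu a < +oo)%E].
Hypothesis h_irr : communicates mu (orthant_on finset.set0).
Variables (a : 'rV[R]_d) (rho : R) (rho01 : 0 <= rho < 1)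
  (ha : (laplace mu a <= rho%:E)%E).
Local Notation g := (gfree mu).
Variable i0 : 'I_d.
Hypothesis h_pos : 0 < M i0.

Lemma ratio_step_unif (e : R) : 0 < e -> exists c C : R, [/\ 0 < c, 0 <= C &
  forall i b t (y z : V), M i0 / 2 * t%:R <= (y 0 i0)%:~R - (z 0 i0)%:~R ->
    g y (z + unitv i b) <= (1 + e) * g y z + C * expR (- (c * t%:R))].
Proof.
move=> e0.
have h (ib : 'I_d * bool) : exists cC : R * R, [/\ 0 < cC.1, 0 <= cC.2 &
    forall t (y z : V), M i0 / 2 * t%:R <= (y 0 i0)%:~R - (z 0 i0)%:~R ->
    g y (z + unitv ib.1 ib.2) <= (1 + e) * g y z + cC.2 * expR (- (cC.1 * t%:R))].
  have [c [C [c0 C0 hc]]] := ratio_step hmu h_exp h_irr rho01 ha h_pos ib.1 ib.2 e0.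
  by exists (c, C).
have [F hF] := choice h.
have F0 ib : 0 < (F ib).1 by have [] := hF ib.
have [c [c0 _ hc]] := fin_lower F0.
exists c, (\sum_ib (F ib).2); split => //.
  by apply: sumr_ge0 => ib _; have [] := hF ib.
move=> i b t y z hyz; have [F1 F2 hib] := hF (i, b).
apply: le_trans (hib t y z hyz) _; rewrite lerD2l; apply: ler_pM => //.
- by rewrite (bigD1 (i, b))//= lerDl sumr_ge0// => ib _; have [] := hF ib.
- by rewrite ler_expR lerN2 ler_wpM2r// hc.
Qed.

Lemma nearM_le (e e' : R) t y : e <= e' -> nearM mu e t y -> nearM mu e' t y.
Proof.
move=> ee /forallP h; apply/forallP => i; apply: le_trans (h i) _.
by rewrite ler_wpM2r.
Qed.

Lemma coord_norm1 (z : V) i : (z 0 i)%:~R <= (norm1 z)%:R :> R.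
Proof.
apply: le_trans (ler_norm _) _.
rewrite -intr_norm -natr_absz ler_nat /norm1 (bigD1 i)//=; exact: leq_addr.
Qed.

(** The order of the constants matters: [tau] is the loss per step compatible with the weight, [c]
    the rate of the ratio step for [tau / 2], [eta] keeps the Harnack loss below [c / 4], [d1] is
    then the rate of the lower bound, and [D] the precision it requires. *)
Lemma gfree_ratio (th e : R) : 0 < th -> 0 < e -> exists D : R, 0 < D /\
  exists t0, forall t, (t0 <= t)%N -> forall y, nearM mu D t y ->
  forall z, `|g y z - g y 0| <= th * expR (e * (norm1 z)%:R) * g y 0.
Proof.
move=> th0 e0.
have [tau tauE] : exists tau : R, tau = Num.min th 1 * e / 2 by eexists.
have tau0 : 0 < tau by rewrite tauE divr_gt0// mulr_gt0// lt_min th0 ltr01.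
have tau2 : 0 < tau / 2 by rewrite divr_gt0.
have [c [C [c0 C0 hc]]] := ratio_step_unif tau2.
have [l l0 hl] := harnack_exp hmu h_irr rho01 ha.
have [eta [eta0 etac etaM]] : exists eta : R, [/\ 0 < eta, l * eta <= c / 4 & eta <= M i0 / 4].
  have l1 : 0 < 4 * (l + 1) by rewrite mulr_gt0//; lra.
  exists (Num.min (c / (4 * (l + 1))) (M i0 / 4)); split.
  - by rewrite lt_min !divr_gt0.
  - apply: (@le_trans _ _ (l * (c / (4 * (l + 1))))).
      by rewrite ler_wpM2l// ge_min lexx.
    by rewrite mulrA ler_pdivrMr//; nra.
  - by rewrite ge_min lexx orbT.
have [d1 [d10 d1c d1e]] : exists d1 : R, [/\ 0 < d1, d1 <= c / 4 & d1 <= e * eta / 2].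
  exists (Num.min (c / 4) (e * eta / 2)); split.
  - by rewrite lt_min !divr_gt0// mulr_gt0.
  - by rewrite ge_min lexx.
  - by rewrite ge_min lexx orbT.
have [e1 [e10 [t1 ht1]]] := gfree_lower hmu h_exp h_irr rho01 ha d10.
have [D [D0 De DM]] : exists D : R, [/\ 0 < D, D <= e1 & D <= M i0 / 4].
  exists (Num.min e1 (M i0 / 4)); split.
  - by rewrite lt_min e10 divr_gt0.
  - by rewrite ge_min lexx.
  - by rewrite ge_min lexx orbT.
have c2 : 0 < c / 2 by rewrite divr_gt0.
have ee2 : 0 < e * eta / 2 by rewrite divr_gt0// mulr_gt0.
have [m [m0 hm]] : exists m : R, 0 <= m /\ forall y z : V, 0 <= g y z <= m.
  exists (1 - rho)^-1; split; last by move=> y z; exact: (gfree_le hmu rho01 ha).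
  by rewrite invr_ge0 subr_ge0; have /andP[_ /ltW] := rho01.
have [t2 ht2] := exp_large (C / (tau / 2)) c2.
have [t3 ht3] := exp_large ((1 + m) / th) ee2.
exists D; split => //; exists (maxn t1 (maxn t2 t3)) => t.
rewrite !geq_max => /and3P[/ht1 {}ht1 /ht2 {}ht2 /ht3 {}ht3] y yD z.
have tp : 0 <= t%:R :> R by exact: ler0n.
have g0 := ht1 y (nearM_le De yD).
have gp : 0 < g y 0 by apply: lt_le_trans g0; exact: expR_gt0.
(* Far points: half of the exponent [e * eta * t] beats the lower bound for [g y 0], the other half
   the constant [(1 + m) / th]. *)
have [hz|hz] := leP (norm1 z)%:R (eta * t%:R); last first.
  have h1 : expR (e * eta / 2 * t%:R) * expR (e * eta / 2 * t%:R) <= expR (e * (norm1 z)%:R).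
    rewrite -expRD ler_expR; have := ler_wpM2l (ltW e0) (ltW hz); lra.
  have h2 : 1 <= expR (d1 * t%:R) * g y 0.
    rewrite -(ler_pM2l (expR_gt0 (- (d1 * t%:R)))) mulr1 mulrA -expRD addNr expR0.
    by rewrite mul1r.
  have h3 : expR (d1 * t%:R) <= expR (e * eta / 2 * t%:R).
    by rewrite ler_expR ler_wpM2r.
  rewrite ler_pdivrMr// mulrC in ht3.
  have h4 : (1 + m) <= th * expR (e * eta / 2 * t%:R) * (expR (e * eta / 2 * t%:R) * g y 0).
    rewrite -[leLHS]mulr1; apply: ler_pM => //; first lra.
    by apply: le_trans h2 _; rewrite ler_wpM2r// ltW.
  have h5 := ler_wpM2r (ltW gp) (ler_wpM2l (ltW th0) h1).
  have /andP[z0 z1] := hm y z.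
  have /andP[_ z2] := hm y 0.
  have : `|g y z - g y 0| <= m by rewrite ler_norml; apply/andP; split; lra.
  move: h4 h5; set E := expR (e * eta / 2 * t%:R).
  by rewrite [th * E * _]mulrA -[th * E * E]mulrA; lra.
(* Here [y] is at least [3 M t / 4] and [u] at most [M t / 4] in coordinate [i0], so the ratio step
   applies. Harnack gives [g y u >= exp (- c t / 2)], so the additive error is at most
   [tau / 2 * g y u]. *)
have chain i b u : (norm1 u <= Num.truncn (eta * t%:R))%N ->
    g y (u + unitv i b) <= (1 + tau) * g y u.
  move=> hu; have {}hu : (norm1 u)%:R <= eta * t%:R.
    apply: le_trans (_ : (Num.truncn (eta * t%:R))%:R <= _); first by rewrite ler_nat.
    by have /andP[] := truncn_itv (mulr_ge0 (ltW eta0) tp).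
  apply: le_trans (hc i b t y u _) _.
    have := coord_norm1 u i0; have := ler_wpM2r tp etaM; have := ler_wpM2r tp DM.
    have /forallP/(_ i0) := yD; rewrite ler_norml => /andP[h _].
    lra.
  have h1 : expR (- (c / 2 * t%:R)) <= g y u.
    have [_ h] := hl y u.
    rewrite -(ler_pM2l (expR_gt0 (l * (norm1 u)%:R))).
    apply: le_trans h; apply: le_trans g0; rewrite -expRD ler_expR.
    have := ler_wpM2l l0 hu; have := ler_wpM2r tp etac; have := ler_wpM2r tp d1c; lra.
  rewrite ler_pdivrMr// in ht2.
  have h2 : C * expR (- (c * t%:R)) <= tau / 2 * expR (- (c / 2 * t%:R)).
    have -> : - (c * t%:R) = - (c / 2 * t%:R) + - (c / 2 * t%:R) by field.
    rewrite expRD mulrA ler_wpM2r ?expR_ge0// expRN ler_pdivrMr ?expR_gt0//.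
    by rewrite mulrC.
  have := ler_wpM2l (ltW tau2) h1; lra.
have [|h1 h2] := norm1_chain (F := g y) (C := 1 + tau) (ltW (ltr_wpDl (ltW ltr01) tau0))
   (fun u i b => chain i b u) (z := z).
  by rewrite truncn_ge_nat// mulr_ge0// ltW.
set X := (1 + tau) ^+ norm1 z in h1 h2.
have hX : X - 1 <= th * expR (e * (norm1 z)%:R).
  apply: le_trans (expR_growth th0 e0 (ler0n _ _)).
  rewrite -tauE lerD2r /X -expR_nat lerXn2r ?nnegrE ?expR_ge0//; first lra.
  exact: expR_ge1Dx.
have X1 : 1 <= X by rewrite exprn_ege1//; lra.
have /andP[z0 z1] := hm y z.
apply: le_trans (ler_wpM2r (ltW gp) hX).
rewrite ler_norml; apply/andP; split; last by lra.
(* If [g y z <= g y 0], then [g y 0 <= X * g y z] bounds the difference by [(X - 1) * g y z], hence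
   by [(X - 1) * g y 0]. *)
by have [hzz|hzz] := leP (g y z) (g y 0); nra.
Qed.

End KeyEstimate.

(** * The killed walk *)

Section Killed.
Variables (R : realType) (d : nat).
Local Notation V := 'rV[int]_d.
Variables (mu : V -> R) (hmu : prob_mass mu).
Local Notation T := (step mu).

Definition inA (z : V) : bool := [forall i, 0 < z 0 i].

Lemma orthantP (z : V) : orthant z <-> inA z.
Proof. by split => [h|/forallP//]; apply/forallP. Qed.

(** The indicator tests the starting point only; the final position is restricted by the function to
    which an iterate is applied. *)
Definition kstep (f : V -> R) : V -> R := fun x => (inA x)%:R * T f x.
Local Notation K := kstep.

Let tT : tiop T. Proof. exact: tiop_step. Qed.

Lemma bd_kstep f : bd f -> bd (K f).
Proof. by move=> bf; apply: (@bd_ind _ _ inA); exact: bd_step. Qed.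

Lemma bd_iterk n f : bd f -> bd (iter n K f).
Proof. by move=> bf; elim: n => //= n; exact: bd_kstep. Qed.

Lemma iterkD n f h : bd f -> bd h ->
  iter n K (fun z => f z + h z) = (fun x => iter n K f x + iter n K h x).
Proof.
move=> bf bh; elim: n => //= n ->; apply/funext => x; rewrite /kstep.
by rewrite stepD//; [rewrite mulrDr|exact: bd_iterk..].
Qed.

Lemma iterkZ n c f : bd f -> iter n K (fun z => c * f z) = (fun x => c * iter n K f x).
Proof.
move=> bf; elim: n => //= n ->; apply/funext => x; rewrite /kstep.
by rewrite stepZ//; [rewrite mulrCA|exact: bd_iterk].
Qed.

Lemma iterk_ge0 n f x : (forall z, 0 <= f z) -> 0 <= iter n K f x.
Proof.
move=> f0; elim: n x => //= n IHn x; rewrite /kstep mulr_ge0//.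
exact: step_ge0.
Qed.

Lemma iterk_le n f h x : bd f -> bd h -> (forall z, f z <= h z) ->
  iter n K f x <= iter n K h x.
Proof.
move=> bf bh fh; elim: n x => //= n IHn x; rewrite /kstep ler_wpM2l//.
by apply: step_le => //; exact: bd_iterk.
Qed.

Lemma iterk_step n f x : bd f -> (forall z, 0 <= f z) -> iter n K f x <= iter n T f x.
Proof.
move=> bf f0; elim: n x => //= n IHn x; rewrite /kstep.
have h : T (iter n K f) x <= T (iter n T f) x.
  by apply: step_le => //; [exact: bd_iterk|exact: bd_iter].
case: (inA x); rewrite ?mul1r// mul0r; apply: step_ge0 => // z.
exact: iter_ge0.
Qed.

Lemma kstep_expand f s : bd f -> bd s -> (forall x, f x = s x + K f x) ->
  forall n x, f x = \sum_(0 <= t < n) iter t K s x + iter n K f x.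
Proof.
move=> bf bs fE; elim=> [|n IHn] x; first by rewrite big_nil add0r.
rewrite IHn big_nat_recr//= -addrA; congr (_ + _).
rewrite -iterS iterSr.
have -> : f = fun z => s z + K f z by apply/funext.
rewrite iterkD//; last exact: bd_kstep.
by congr (_ + iter n K (K _) x); apply/funext.
Qed.

(** The contribution of an exit at the next step: summing [K^t (exitop f)] over [t < n] gives the
    expectation of [f(S(tau))] on [1 <= tau <= n]. *)
Definition exitop (f : V -> R) : V -> R :=
  fun x => (inA x)%:R * T (fun z => (~~ inA z)%:R * f z) x.

Lemma bd_exitop f : bd f -> bd (exitop f).
Proof.
move=> bf; apply: (@bd_ind _ _ inA); apply: bd_step => //.
exact: (@bd_ind _ _ (fun z => ~~ inA z)).
Qed.

Lemma exitop_abs f x : bd f -> `|exitop f x| <= exitop (fun z => `|f z|) x.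
Proof.
move=> bf; rewrite /exitop normrM normr_nat ler_wpM2l//.
apply: le_trans (step_abs hmu x _) _; first exact: (@bd_ind _ _ (fun z => ~~ inA z)).
rewrite le_eqVlt; apply/orP; left; apply/eqP; congr (T _ x).
by apply/funext => z; rewrite normrM normr_nat.
Qed.

Lemma iterk_abs n f x : bd f -> `|iter n K f x| <= iter n K (fun z => `|f z|) x.
Proof.
move=> bf; elim: n x => //= n IHn x; rewrite /kstep normrM normr_nat ler_wpM2l//.
apply: le_trans (step_abs hmu x (bd_iterk n bf)) _.
by apply: step_le => //; [apply: bd_abs|apply: bd_iterk; apply: bd_abs];
   rewrite //; exact: bd_iterk.
Qed.

Definition indA : V -> R := fun z => (inA z)%:R.

Lemma bd_indA : bd indA.
Proof. by apply: (@bd_le _ _ 1) => z; rewrite ler0n lern1 leq_b1. Qed.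

Lemma kstep_split f x : bd f ->
  (inA x)%:R * T f x = exitop f x + K (fun z => (inA z)%:R * f z) x.
Proof.
move=> bf; rewrite /exitop /kstep -mulrDr; congr (_ * _).
have := stepD hmu (@bd_ind _ _ (fun z => ~~ inA z) _ bf) (@bd_ind _ _ inA _ bf).
move=> /(congr1 (fun u => u x)) <-; congr (T _ x); apply/funext => z.
by case: (inA z); rewrite /= ?mul0r ?mul1r ?addr0 ?add0r.
Qed.

(** The first-exit decomposition of the constant [1]. *)
Lemma survive_expand n x :
  indA x = \sum_(0 <= t < n) iter t K (exitop (fun=> 1)) x + iter n K indA x.
Proof.
apply: kstep_expand; [exact: bd_indA|by apply: bd_exitop; exact: bd_cst|] => u.
have := kstep_split u (bd_cst d (1 : R)); rewrite step_cst// mulr1 => h.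
rewrite /indA [LHS]h; congr (_ + K _ u).
by apply/funext => z; rewrite mulr1.
Qed.

(* At each exit point [u] is dominated by one of finitely many exponentials, all
   of which the walk contracts by the factor [rho]. *)
Lemma exit_bound (I : finType) (b : I -> 'rV[R]_d) (rho c : R) (u : V -> R) n x :
  0 <= rho < 1 -> 0 <= c -> (forall k, (laplace mu (b k) <= rho%:E)%E) ->
  bd u -> (forall z, 0 <= u z) ->
  (forall z, ~~ inA z -> exists k, u z <= c * expR (dotp (b k) (intv R z))) ->
  \sum_(0 <= t < n) iter t K (exitop u) x <=
    c * ((1 - rho)^-1 * \sum_k expR (dotp (b k) (intv R x))).
Proof.
move=> /andP[r0 r1] c0 hb bu u0 hu.
pose v k z : R := (~~ inA z && (u z <= c * expR (dotp (b k) (intv R z))))%R%:R * u z.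
have bv k : bd (v k).
  exact: (@bd_ind _ _ (fun z => ~~ inA z && (u z <= c * expR (dotp (b k) (intv R z))))).
have v0 k z : 0 <= v k z by rewrite /v mulr_ge0.
have ve k z : v k z <= c * expR (dotp (b k) (intv R z)).
  rewrite /v; case: (inA z) => /=; first by rewrite mul0r mulr_ge0 ?expR_ge0.
  by case: (boolP (u z <= _)) => [h|_] /=; rewrite ?mul1r// mul0r mulr_ge0 ?expR_ge0.
have bB : bd (fun z => (~~ inA z)%:R * u z) by exact: (@bd_ind _ _ (fun z => ~~ inA z)).
(* Killing is dropped, except for the requirement that the last position be outside; there the
   pieces [v k], which may overlap, cover [u]. *)
have uv t : iter t K (exitop u) x <= \sum_k iter t.+1 T (v k) x.
  have bE : bd (exitop u) by exact: bd_exitop.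
  apply: le_trans (iterk_step t x bE _) _.
    move=> z; rewrite /exitop mulr_ge0//; apply: step_ge0 => // z'.
    by rewrite mulr_ge0.
  apply: (@le_trans _ _ (iter t.+1 T (fun z => (~~ inA z)%:R * u z) x)).
    rewrite iterSr; apply: (tiop_le x (tiop_iter t tT)) => //; first exact: bd_step.
    move=> z; rewrite /exitop; case: (inA z); rewrite ?mul1r// mul0r.
    by apply: step_ge0 => // z'; rewrite mulr_ge0.
  have tO := tiop_iter t.+1 tT.
  have [bS <-] := tiop_sum (index_enum I) x tO bv.
  apply: (tiop_le x tO bB bS) => z; case: (boolP (inA z)) => zA /=.
    by rewrite mul0r; apply: sumr_ge0 => k _.
  have [k hk] := hu z zA; rewrite mul1r (bigD1 k)//= {1}/v zA hk mul1r.
  by rewrite lerDl; apply: sumr_ge0.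
apply: le_trans (ler_sum _ (fun t _ => uv t)) _.
rewrite exchange_big/= !mulr_sumr; apply: ler_sum => k _.
apply: (@le_trans _ _ (\sum_(0 <= t < n) (c * expR (dotp (b k) (intv R x))) * rho ^+ t)).
  apply: ler_sum => t _.
  apply: le_trans (iter_exp hmu t.+1 x r0 (hb k) c0 (bv k) (v0 k) (ve k)) _.
  rewrite mulrAC ler_wpM2l ?mulr_ge0 ?expR_ge0// exprS ler_piMl ?exprn_ge0//.
  exact: ltW.
rewrite -mulr_sumr -mulrA ler_wpM2l// mulrC ler_wpM2r ?expR_ge0//.
by apply: geom_sum_le; rewrite r0.
Qed.

End Killed.

(** * Survival probability and asymptotics of the killed Green function *)

Section KilledLimit.
Variables (R : realType) (d : nat).
Local Notation V := 'rV[int]_d.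
Variables (mu : V -> R) (hmu : prob_mass mu).
Local Notation T := (step mu).
Local Notation K := (kstep mu).
Local Notation M := (drift mu 0).
Local Notation g := (gfree mu).
Local Notation indA := (@indA R d).

(** [surv n], [escape] and [gkilled] are the operator forms of [P_x(tau > n)], [P_x(tau = oo)] and
    of [G(x, y)] for [y] in the orthant; [prob_stay], [survivalE] and [green_gkilled] make the
    link. *)
Definition surv n (x : V) : R := iter n K indA x.

Definition escape x : R := limn (surv^~ x).

Definition gkpart n y x : R := \sum_(0 <= t < n) iter t K (ind R y) x.

Definition gkilled y x : R := limn (fun n => gkpart n y x).

Lemma indAE z : indA z = (inA z)%:R. Proof. by []. Qed.

Lemma indA_ge0 z : 0 <= indA z. Proof. exact: ler0n. Qed.

Lemma surv_ni x : nonincreasing_seq (surv^~ x).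
Proof.
apply/nonincreasing_seqP => n; rewrite /surv iterSr; apply: iterk_le => //.
- by apply: bd_kstep => //; exact: bd_indA.
- exact: bd_indA.
- move=> z; rewrite [leRHS](survive_expand hmu 1) big_nat1/= lerDr.
  by rewrite /exitop mulr_ge0//; apply: step_ge0 => // z'; rewrite mulr_ge0.
Qed.

Lemma surv01 n x : 0 <= surv n x <= 1.
Proof.
apply/andP; split; first by apply: iterk_ge0 => // z; exact: indA_ge0.
apply: le_trans (surv_ni x (leq0n n)) _.
by rewrite /surv/= indAE lern1 leq_b1.
Qed.

Lemma surv_cvg x : surv n x @[n --> \oo] --> escape x.
Proof.
apply: nonincreasing_is_cvgn; first exact: surv_ni.
by exists 0 => _ [n _ <-]; have /andP[] := surv01 n x.
Qed.

Lemma escape01 x : 0 <= escape x <= 1.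
Proof.
apply/andP; split.
  by apply: (cvgr_to_ge (@surv_cvg x)); apply: nearW => n; have /andP[] := surv01 n x.
by apply: (cvgr_to_le (@surv_cvg x)); apply: nearW => n; have /andP[] := surv01 n x.
Qed.

Lemma bd_escape : bd escape. Proof. exact: bd_le escape01. Qed.

Lemma escapeE x : escape x = K escape x.
Proof.
have h : surv n.+1 x @[n --> \oo] --> escape x.
  by rewrite (@cvg_shiftS _ (surv^~ x)); exact: surv_cvg.
rewrite -(cvg_lim (@Rhausdorff R) h); apply: (cvg_lim (@Rhausdorff R)).
rewrite /surv/= /kstep; apply: cvgZr.
apply: (step_cvg hmu (C := 1)); last exact: surv_cvg.
by move=> n u; have /andP[h1 h2] := surv01 n u; rewrite ger0_norm.
Qed.

Lemma escape_out x : ~~ inA x -> escape x = 0.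
Proof. by move=> /negPf xA; rewrite escapeE /kstep xA mul0r. Qed.

(** Invariance under [K] carries positivity backwards along a path in the orthant. *)
Lemma escape_chain k (z : nat -> V) : (forall j, (j <= k)%N -> inA (z j)) ->
  (forall j, (1 <= j <= k)%N -> 0 < mu (z j - z j.-1)) ->
  0 < escape (z k) -> 0 < escape (z 0%N).
Proof.
elim: k z => // k IHk z zA hz zk.
have z1 : 0 < escape (z 1%N).
  apply: (IHk (fun j => z j.+1)) => //; first by move=> j jk; exact: zA.
  by move=> [//|j] jk; exact: (hz j.+2).
rewrite escapeE /kstep zA// mul1r.
apply: lt_le_trans (step_ge_atom hmu (z 0%N) (z 1%N - z 0%N) bd_escape _).
  by rewrite (addrC (z 0%N)) subrK mulr_gt0// (hz 1%N).
by move=> u; have /andP[] := escape01 u.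
Qed.

Section Params.
Hypothesis h_exp : set_nbhs (sublevel1 mu) [set a | (laplace mu a < +oo)%E].
Hypothesis h_pos : forall i, 0 < M i.

(** An exit point has a coordinate [z_i <= 0], where [1 <= exp (- s z_i)]; from the diagonal point
    at height [L + 1] the exit probability is thus at most [d exp (- s (L + 1)) / (1 - rho)], which
    is at most [1 / 2]. *)
Lemma escape_deep : exists x : V, inA x /\ 0 < escape x.
Proof.
have [s [rho [s0 rho01 hs]]] := neg_params hmu h_exp h_pos.
have [L hL] := exp_large (2 * ((1 - rho)^-1 * d%:R)) s0.
exists (const_mx (L.+1)%:Z); split; first by apply/forallP => i; rewrite mxE.
set x := const_mx _ : V; apply: (@lt_le_trans _ _ (1 / 2)) => //.
apply: (cvgr_to_ge (@surv_cvg x)); apply: nearW => n.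
have := survive_expand hmu n x; rewrite [indA x]indAE.
have -> : inA x by apply/forallP => i; rewrite mxE.
have := @exit_bound _ _ _ hmu _ (fun i => dir i (- s)) rho 1 (fun=> 1) n x rho01
  ler01 hs (bd_cst d 1) (fun=> ler01) _.
rewrite mul1r => h.
have {}h : \sum_(0 <= t < n) iter t K (exitop mu (fun=> 1)) x <= 1 / 2.
  apply: le_trans (h _) _.
    move=> z; rewrite negb_forall => /existsP[i]; rewrite -leNgt => zi; exists i.
    rewrite mul1r dotp_dir -[leLHS]expR0 ler_expR mulNr oppr_ge0.
    by rewrite mulr_ge0_le0 ?(ltW s0)// lerz0.
  rewrite (eq_bigr (fun=> expR (- (s * L.+1%:R)))); last first.
    by move=> i _; rewrite dotp_dir mxE mulNr.
  rewrite sumr_const card_ord -[X in _ * X]mulr_natl mulrA expRN.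
  rewrite ler_pdivrMr ?expR_gt0//; have := hL L.+1 (leqnSn _); lra.
rewrite /surv; set S := \sum_(_ <= _ < _) _ in h *.
by rewrite mulr1n => h2; lra.
Qed.

Lemma escape_gt0 x : communicates mu (orthant_on finset.setT) -> inA x -> 0 < escape x.
Proof.
move=> hirr xA; have [x1 [x1A hx1]] := escape_deep.
have oA (z : V) : inA z -> orthant_on finset.setT z by move=> /forallP h i _; exact: h.
have Ao (z : V) : orthant_on finset.setT z -> inA z.
  by move=> h; apply/forallP => i; apply: h; rewrite finset.in_setT.
have [k [z [z0 zk zA hz]]] := hirr _ _ (oA _ xA) (oA _ x1A).
rewrite -z0; apply: (escape_chain _ hz); last by rewrite zk.
by move=> j jk; apply: Ao; exact: zA.
Qed.

Hypothesis h_irr : communicates mu (orthant_on finset.set0).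
Variables (a : 'rV[R]_d) (rho : R) (rho01 : 0 <= rho < 1)
  (ha : (laplace mu a <= rho%:E)%E).

Lemma gkpart_nd y x : nondecreasing_seq (fun n => gkpart n y x).
Proof.
apply/nondecreasing_seqP => n; rewrite /gkpart big_nat_recr//= lerDl.
by apply: iterk_ge0 => // z; exact: ind_ge0.
Qed.

Lemma gkpart_le n y x : gkpart n y x <= (1 - rho)^-1.
Proof.
have /andP[_] := gpart_le hmu rho01 ha n y x; apply: le_trans.
apply: ler_sum => t _; by apply: iterk_step => //; exact: bd_indy.
Qed.

Lemma gkpart_cvg y x : gkpart n y x @[n --> \oo] --> gkilled y x.
Proof.
apply: nondecreasing_is_cvgn; first exact: gkpart_nd.
by exists (1 - rho)^-1 => _ [n _ <-]; exact: gkpart_le.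
Qed.

(* The first-exit decomposition is applied to [g y - g y 0], so that the Green
   function and the survival probability come out at once. *)
Lemma gkilled_compare n y x : inA y -> `|gkpart n y x - g y 0 * surv n x| <=
  `|g y x - g y 0| + (\sum_(0 <= t < n) iter t K (exitop mu (fun z => `|g y z - g y 0|)) x
  + iter n T (g y) x).
Proof.
move=> yA; set g0 := g y 0.
have bg := bd_gfree hmu rho01 ha y.
have gp z : 0 <= g y z by have /andP[] := gfree_le hmu rho01 ha y z.
pose dg z := g y z + - g0 * 1.
have bc (c : R) : bd (fun _ : V => c) := bd_cst d c.
have bdg : bd dg by apply: bdD => //; exact: bd_cst.
have bI u : bd u -> bd (fun z => indA z * u z) by exact: (@bd_ind _ _ (@inA d)).
pose f z := indA z * dg z.
pose s z := ind R y z + exitop mu dg z.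
have be : bd (exitop mu dg) by exact: bd_exitop.
have bi : bd (ind R y) by exact: bd_indy.
have bs : bd s by exact: bdD.
(* Constants are invariant under [T], so [dg] satisfies the same equation as [g y]; as [y] is in the
   orthant, the source [ind y] survives the restriction. *)
have fE z : f z = s z + K f z.
  rewrite /s -addrA -kstep_split// /f indAE.
  case: (boolP (inA z)) => zA; last first.
    rewrite !mul0r addr0 /ind; case: eqVneq => // zy.
    by rewrite zy yA in zA.
  rewrite !mul1r /dg [in LHS](gfreeE hmu rho01 ha) -addrA; congr (_ + _).
  by rewrite (stepD hmu bg (bc (- g0 * 1))) step_cst.
have := kstep_expand hmu (bI _ bdg) bs fE n x.
have -> : \sum_(0 <= t < n) iter t K s x =
    gkpart n y x + \sum_(0 <= t < n) iter t K (exitop mu dg) x.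
  rewrite /gkpart -big_split/=; apply: eq_bigr => t _.
  by rewrite /s iterkD.
have -> : iter n K f x = iter n K (fun z => indA z * g y z) x - g0 * surv n x.
  have -> : f = fun z => indA z * g y z + - g0 * indA z.
    by apply/funext => z; rewrite /f /dg; ring.
  rewrite iterkD//; [|exact: bI|by apply: bdZ; exact: bd_indA].
  by rewrite iterkZ// ?mulNr//; exact: bd_indA.
set S := \sum_(0 <= t < n) _; set F := iter n K _ _ => hf.
have -> : gkpart n y x - g0 * surv n x = f x - (S + F).
  by move: hf; rewrite -/(f x) => hf; lra.
apply: le_trans (ler_normB _ _) _; apply: lerD.
  rewrite /f indAE /dg mulr1; case: (inA x); rewrite ?mul1r//.
  by rewrite mul0r normr0.
apply: le_trans (ler_normD _ _) _; apply: lerD.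
  apply: le_trans (ler_norm_sum _ _ _) _; apply: ler_sum => t _.
  apply: le_trans (iterk_abs hmu t x be) _.
  have -> : (fun z => `|g y z - g0|) = fun z => `|dg z|.
    by apply/funext => z; rewrite /dg mulr1.
  apply: iterk_le => //; [exact: bd_abs|by apply: bd_exitop => //; exact: bd_abs|].
  by move=> z; exact: exitop_abs.
have bIg := bI _ bg.
have Ig0 z : 0 <= indA z * g y z by rewrite mulr_ge0// indA_ge0.
rewrite /F ger0_norm; last exact: iterk_ge0.
apply: le_trans (iterk_step hmu n x bIg Ig0) _.
apply: (tiop_le x (tiop_iter n (tiop_step hmu))) => // z.
by rewrite ler_piMl// indAE lern1 leq_b1.
Qed.

Lemma norm1_max (i0 : 'I_d) (z : V) : exists j, (norm1 z <= d * absz (z 0 j)%R)%N.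
Proof.
have [j _ hj] := arg_maxnP (P := xpredT) (fun j => absz (z 0 j)) (i0 := i0) isT.
exists j; rewrite /norm1 -[X in (_ <= X * _)%N](card_ord d) -sum_nat_const.
by apply: leq_sum => i _; exact: hj.
Qed.

(** The weighted bound of [gfree_ratio] enters at [x] and at the exit position. There [norm1 z] is
    at most [d] times the largest [|z_j|], whence the rate [e / d], and the weight is below one of
    the exponentials of [exp_params]. *)
Lemma gkilled_limit (i0 : 'I_d) x th : 0 < th -> exists D : R, 0 < D /\
  exists t0, forall t, (t0 <= t)%N -> forall y, inA y -> nearM mu D t y ->
  `|gkilled y x - g y 0 * escape x| <= th * g y 0.
Proof.
move=> th0.
have [s [e [r [s0 e0 r01 hse]]]] := exp_params hmu h_exp h_pos.
have dp : 0 < d%:R :> R by rewrite ltr0n (leq_ltn_trans _ (ltn_ord i0)).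
(* [k] consists of a coordinate that is nonpositive at the exit, a coordinate of largest absolute
   value, and the sign of the latter. *)
pose b (k : 'I_d * 'I_d * bool) := dir k.1.1 (- s) + dir k.1.2 (if k.2 then - e else e).
have hb k : (laplace mu (b k) <= r%:E)%E.
  by have [h1 h2] := hse k.1.1 k.1.2; rewrite /b; case: k.2.
pose e' := e / d%:R.
have e'0 : 0 < e' by rewrite divr_gt0.
pose Cx := (1 - r)^-1 * \sum_k expR (dotp (b k) (intv R x)).
have Cx0 : 0 <= Cx.
  rewrite mulr_ge0 ?invr_ge0 ?sumr_ge0//.
  by have /andP[_ r1] := r01; rewrite subr_ge0 ltW.
pose Ex := expR (e' * (norm1 x)%:R).
have Ex0 : 0 < Ex by exact: expR_gt0.
have CE : 0 < Ex + Cx by rewrite ltr_wpDr.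
(* [Ex] is the cost of the starting point, [Cx] that of the exit position. *)
pose th' := th / (Ex + Cx).
have th'0 : 0 < th' by rewrite divr_gt0.
have [D [D0 [t0 ht0]]] := gfree_ratio hmu h_exp h_irr rho01 ha (h_pos i0) th'0 e'0.
exists D; split => //; exists t0 => t tt y yA yD.
have hy := ht0 t tt y yD.
have gp z : 0 <= g y z by have /andP[] := gfree_le hmu rho01 ha y z.
have bg := bd_gfree hmu rho01 ha y.
have bdg : bd (fun z => `|g y z - g y 0|) by apply: bd_abs; apply: bdD => //; exact: bd_cst.
have key n : `|gkpart n y x - g y 0 * surv n x| <= th * g y 0 + iter n T (g y) x.
  apply: le_trans (gkilled_compare n x yA) _; rewrite addrA lerD2r.
  have hW := exit_bound hmu n x r01 (mulr_ge0 (ltW th'0) (gp 0)) hb bdg (fun z => normr_ge0 _) _.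
  apply: (@le_trans _ _ (th' * Ex * g y 0 + th' * g y 0 * Cx)).
    apply: lerD; first exact: hy.
    apply: hW => z; rewrite negb_forall => /existsP[i]; rewrite -leNgt => zi.
    have [j hj] := norm1_max i0 z.
    exists (i, j, z 0 j < 0)%R; apply: le_trans (hy z) _.
    rewrite mulrAC ler_wpM2l ?(mulr_ge0 (ltW th'0))// ler_expR dotpDl !dotp_dir.
    have h1 : 0 <= - s * (z 0 i)%:~R by rewrite mulNr oppr_ge0 mulr_ge0_le0 ?(ltW s0)// lerz0.
    suff : e' * (norm1 z)%:R <= (if z 0 j < 0 then - e else e) * (z 0 j)%:~R by rewrite /=; lra.
    apply: (@le_trans _ _ (e' * (d%:R * (absz (z 0 j))%:R))).
      by rewrite ler_wpM2l ?(ltW e'0)// -natrM ler_nat.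
    rewrite mulrA divfK ?gt_eqF// natr_absz.
    case: ifPn => zj; first by rewrite ltr0_norm// intrN mulrN mulNr.
    by rewrite ger0_norm// leNgt.
  have -> : th' * Ex * g y 0 + th' * g y 0 * Cx = th' * (Ex + Cx) * g y 0 by ring.
  by rewrite /th' divfK// gt_eqF.
have hc : `|gkpart n y x - g y 0 * surv n x| @[n --> \oo] --> `|gkilled y x - g y 0 * escape x|.
  by apply: cvg_norm; apply: cvgB; [exact: gkpart_cvg|apply: cvgZr; exact: surv_cvg].
have hr : th * g y 0 + iter n T (g y) x @[n --> \oo] --> th * g y 0 + 0.
  by apply: cvgD; [exact: cvg_cst|exact: (iter_gfree_cvg hmu rho01 ha)].
rewrite -[leRHS]addr0; apply: (ler_cvg_to hc hr); exact: nearW.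
Qed.

End Params.
End KilledLimit.

(** * Identification with the probabilistic quantities *)

Section CountableUnion.
Variables (R : realType) (dO : measure_display) (Omega : measurableType dO).
Variables (P : probability Omega R) (I : countType).

(** The family is carried to [nat] by [pickle]; integers that encode nothing receive [set0]. *)
Lemma measure_countable_bigcup (F : I -> set Omega) : (forall i, measurable (F i)) ->
  (forall i j w, F i w -> F j w -> i = j) ->
  P (\bigcup_i F i) = \esum_(i in setT) P (F i).
Proof.
move=> mF dF.
pose G n := if pickle_inv n is Some i then F i else set0.
have mG n : measurable (G n) by rewrite /G; case: (pickle_inv n).
have -> : \bigcup_i F i = \bigcup_n G n.
  apply/seteqP; split=> [w [i _ Fi]|w [n _]].
    by exists (choice.pickle i) => //; rewrite /G pickleK_inv.
  by rewrite /G; case: (pickle_inv n) => // i Fi; exists i.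
rewrite measure_semi_bigcup//; last first.
- exact: bigcupT_measurable.
- move=> m n _ _ [w []]; rewrite /G.
  have := @pickle_invK I m; have := @pickle_invK I n.
  case: (pickle_inv m) => // i; case: (pickle_inv n) => // j /= <- <- Fi Fj.
  by rewrite (dF _ _ _ Fi Fj).
rewrite nneseries_esumT// (@esum_mkcond _ _ setT (fun i => P (F i))).
transitivity (\esum_(n in [set choice.pickle i | i in [set: I]]) P (G n)).
  rewrite [RHS]esum_mkcond; apply: eq_esum => n _; case: ifPn => // /negP h.
  rewrite /G; have := @pickle_invK I n; case: (pickle_inv n) => [i /= hi|]; last by rewrite measure0.
  by exfalso; apply: h; apply/mem_set; exists i.
rewrite esum_image; last by move=> i j _ _; exact: (pcan_inj choice.pickleK).
by apply: eq_esum => i _; rewrite in_setT /G pickleK_inv.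
Qed.

End CountableUnion.

Section Link.
Variables (R : realType) (d : nat).
Local Notation V := 'rV[int]_d.
Variables (mu : V -> R) (hmu : prob_mass mu).
Variables (dO : measure_display) (Omega : measurableType dO).
Variables (P : V -> probability Omega R) (S : nat -> Omega -> V).
Hypothesis hS : random_walk mu P S.
Local Notation K := (kstep mu).

(** A prescribed path up to time [m], then [n] free steps in the orthant ending in [D]. Keeping the
    prescribed past lets the Markov property be derived from the finite-dimensional distributions by
    induction on [n]. *)
Definition pathev m (z : nat -> V) n (D : V -> bool) : set Omega :=
  [set w | [/\ forall k, (k <= m)%N -> S k w = z k,
    forall k, (m <= k <= m + n)%N -> inA (S k w) & D (S (m + n)%N w)]].

Definition indD (D : V -> bool) (z : V) : R := (inA z && D z)%:R.

Lemma bd_indD D : bd (indD D).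
Proof. by apply: (@bd_le _ _ 1) => z; rewrite ler0n lern1 leq_b1. Qed.

Definition extend m (z : nat -> V) (v : V) k := if (k <= m)%N then z k else v.

Lemma pathevS m z n D : inA (z m) ->
  pathev m z n.+1 D = \bigcup_v pathev m.+1 (extend m z v) n D.
Proof.
move=> zA; apply/seteqP; split => [w [h1 h2 h3]|w [v _ [h1 h2 h3]]].
  exists (S m.+1 w) => //; split.
  - move=> k; rewrite leq_eqVlt => /orP[/eqP->|km]; rewrite /extend.
      by rewrite ltnn.
    by rewrite -ltnS km; exact: h1.
  - by move=> k /andP[k1 k2]; apply: h2; rewrite (ltnW k1) addnS -addSn.
  - by rewrite addSn -addnS.
split.
- by move=> k km; rewrite h1 ?(leqW km)// /extend km.
- move=> k /andP[]; rewrite leq_eqVlt => /orP[/eqP<- _|k1 k2].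
    by rewrite h1// /extend leqnn.
  by apply: h2; rewrite k1 addSn -addnS.
- by rewrite addnS -addSn.
Qed.

Lemma pathev_out m z n D : ~~ inA (z m) -> pathev m z n D = set0.
Proof.
move=> zA; apply/seteqP; split => // w [h1 h2 _].
by have := h2 m; rewrite leqnn leq_addr h1// (negPf zA) => /(_ isT).
Qed.

Lemma measurable_cyl m (z : nat -> V) :
  measurable [set w | forall k, (k <= m)%N -> S k w = z k].
Proof.
have -> : [set w | forall k, (k <= m)%N -> S k w = z k] =
    \bigcap_k (if (k <= m)%N then [set w | S k w = z k] else setT).
  apply/seteqP; split => [w h k _|w h k km]; first by case: ifP => // /h.
  by have := h k I; rewrite km.
by apply: bigcapT_measurable => k; case: ifP => // _; exact: hS.1.
Qed.

Lemma pathev0 m z D : inA (z m) ->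
  pathev m z 0 D = if D (z m) then [set w | forall k, (k <= m)%N -> S k w = z k] else set0.
Proof.
move=> zA; apply/seteqP; split => [w [h1 h2]|w].
  by rewrite addn0 h1// => ->.
case: ifP => // Dz h; split => //; last by rewrite addn0 h.
by move=> k; rewrite addn0 => /anti_leq <-; rewrite h.
Qed.

Lemma measurable_pathev m z n D : measurable (pathev m z n D).
Proof.
elim: n m z => [|n IHn] m z; have [zA|zA] := boolP (inA (z m));
  rewrite ?(pathev_out _ _ zA)//.
  by rewrite pathev0//; case: ifP => // _; exact: measurable_cyl.
by rewrite pathevS//; apply: countable_bigcupT_measurable.
Qed.

(** Splitting over the value [v] of [S m.+1] multiplies the weight of the past by [mu (v - z m)];
    the sum over [v] is one application of [K]. *)
Lemma prob_pathev x m z n D : P x (pathev m z n D) =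
  ((z 0%N == x)%:R * (\prod_(0 <= k < m) mu (z k.+1 - z k)) * iter n K (indD D) (z m))%:E.
Proof.
set c := _ * \prod_(_ <= _ < _) _.
have c0 m' z' : 0 <= (z' 0%N == x)%:R * (\prod_(0 <= k < m') mu (z' k.+1 - z' k)).
  by rewrite mulr_ge0// prodr_ge0// => k _; exact: hmu.1.
rewrite {}/c; elim: n m z => [|n IHn] m z; have [zA|zA] := boolP (inA (z m)).
- rewrite pathev0// /= /indD zA /=; case: (D (z m)); last by rewrite measure0 mulr0.
  by rewrite mulr1; exact: hS.2.
- by rewrite pathev_out// measure0 /= /indD (negPf zA) mulr0.
- rewrite pathevS// measure_countable_bigcup; last 2 first.
  + by move=> v; exact: measurable_pathev.
  + move=> v v' w [h1 _ _] [h2 _ _].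
    by have := h1 m.+1 (leqnn _); rewrite h2// /extend ltnn.
  set c := _ * \prod_(_ <= _ < _) _.
  under eq_esum => v _.
    rewrite IHn /extend /= ltnn big_nat_recr//= ltnn leqnn.
    rewrite (eq_big_nat _ _ (F2 := fun k => mu (z k.+1 - z k))); last first.
      by move=> k /andP[_ km]; rewrite km (ltnW km).
    rewrite mulrA -/c -mulrA.
    over.
  have u0 (v : V) : 0 <= iter n K (indD D) v by apply: iterk_ge0 => // u; exact: ler0n.
  rewrite esumZl; [|exact: c0|by move=> v; rewrite mulr_ge0//; exact: hmu.1].
  rewrite /= /kstep zA mul1r [RHS]EFinM; congr (_ * _)%E.
  rewrite /step lsum_nnegE; first last.
  + by apply: summ_step => //; apply: bd_iterk => //; exact: bd_indD.
  + by move=> v; rewrite mulr_ge0//; exact: hmu.1.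
  rewrite (@reindex_esum _ _ _ setT setT (fun v => z m + v)).
    by apply: eq_esum => v _; rewrite addrAC subrr add0r.
  by split.
- by rewrite pathev_out// measure0 /= /kstep (negPf zA) mul0r mulr0.
Qed.

Lemma prob_stay x n (D : V -> bool) :
  measurable [set w | (forall k, (k <= n)%N -> inA (S k w)) /\ D (S n w)] /\
  P x [set w | (forall k, (k <= n)%N -> inA (S k w)) /\ D (S n w)] =
    (iter n K (indD D) x)%:E.
Proof.
have -> : [set w | (forall k, (k <= n)%N -> inA (S k w)) /\ D (S n w)] =
    \bigcup_v pathev 0 (fun=> v) n D.
  apply/seteqP; split => [w [h1 h2]|w [v _ [h1 h2 h3]]].
    exists (S 0%N w) => //; split => //; first by move=> [].
  by split => [k kn|]; [apply: h2|]; rewrite add0n in h3 *.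
have m1 v : measurable (pathev 0 (fun=> v) n D) by exact: measurable_pathev.
split; first exact: countable_bigcupT_measurable.
rewrite measure_countable_bigcup//; last first.
  by move=> u v w [h1 _ _] [h2 _ _]; rewrite -(h1 0%N)// h2.
have u0 (v : V) : 0 <= iter n K (indD D) v by apply: iterk_ge0 => // u; exact: ler0n.
under eq_esum do rewrite prob_pathev big_geq// mulr1.
rewrite -(@esum_set1 R _ x (fun v => (iter n K (indD D) v)%:E)) ?lee_fin//.
rewrite [RHS]esum_mkcond; apply: eq_esum => v _.
by case: eqVneq => [->|vx]; [rewrite mem_set// mul1r|rewrite memNset ?mul0r//=; exact/eqP].
Qed.

Lemma exit_le w n : ~~ inA (S n w) -> (exit_time R S w <= n%:R%:E)%E.
Proof.
move=> hn; apply: ereal_inf_lbound; exists n => //=.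
by move: hn; rewrite negb_forall => /existsP[i]; rewrite -leNgt; exists i.
Qed.

Lemma exit_infty w : (exit_time R S w = +oo)%E <-> forall n, inA (S n w).
Proof.
split => [h n|h].
  by apply/negPn/negP => /exit_le; rewrite h leye_eq.
rewrite /exit_time (_ : [set n | _] = set0) ?image_set0 ?ereal_inf0//.
apply/seteqP; split => // n [i]; have /forallP/(_ i) := h n.
by rewrite ltNge => /negP.
Qed.

Lemma exit_gt w t : (t%:R%:E < exit_time R S w)%E <-> forall n, (n <= t)%N -> inA (S n w).
Proof.
split => [h n nt|h].
  apply/negPn/negP => /exit_le hn; move: h; apply/negP; rewrite -leNgt.
  by apply: le_trans hn _; rewrite lee_fin ler_nat.
(* Exit times are integers, so [t + 1] is a lower bound of the infimum and the inequality is
   strict. *)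
apply: (@lt_le_trans _ _ (t.+1%:R)%:E); first by rewrite lte_fin ltr_nat.
apply: le_ereal_inf_tmp => _ [n [i hi] <-]; rewrite lee_fin ler_nat ltnNge.
apply/negP => nt; have /forallP/(_ i) := h n nt.
by rewrite ltNge hi.
Qed.

Lemma greenE x y : inA y ->
  green P S x y = (\sum_(0 <= t <oo) (iter t K (ind R y) x)%:E)%E.
Proof.
move=> yA; rewrite /green; apply: eq_eseriesr => t _.
have -> : ind R y = indD (pred1 y).
  apply/funext => z; rewrite /indD /ind/=.
  by case: eqVneq => [->|_]; rewrite ?yA// andbF.
rewrite -(prob_stay x t (pred1 y)).2; congr (P x _); apply/seteqP; split => w /=.
  by move=> [/eqP h1 /exit_gt h2].
by move=> [h1 /eqP h2]; split => //; apply/exit_gt.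
Qed.

(** Continuity from above along the decreasing events of staying in the orthant up to time [n]. *)
Lemma survivalE x : survival P S x = escape mu x.
Proof.
pose F n := [set w | (forall k, (k <= n)%N -> inA (S k w)) /\ xpredT (S n w)].
have mF n : measurable (F n) := (prob_stay x n xpredT).1.
have e : [set w | exit_time R S w = +oo%E] = \bigcap_n F n.
  apply/seteqP; split => [w /exit_infty h n _|w h]; first by split.
  by apply/exit_infty => n; apply: (h n I).1.
have h : P x (F n) @[n --> \oo] --> P x (\bigcap_n F n).
  apply: nonincreasing_cvg_mu => //.
  - by rewrite (le_lt_trans (probability_le1 (P x) (mF 0%N)))// ltry.
  - exact: bigcapT_measurable.
  - move=> m n mn; apply/subsetPset => w [hw _]; split => // k km.
    by apply: hw; exact: leq_trans mn.
rewrite /survival e; apply/esym; apply: (cvg_lim (@Rhausdorff R)).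
have -> : surv mu ^~ x = fun n => fine (P x (F n)).
  apply/funext => n; rewrite /F (prob_stay x n xpredT).2 /=.
  by congr (iter n K _ x); apply/funext => z; rewrite /indD andbT.
apply: fine_cvg; rewrite fineK//.
by rewrite fin_num_measure//; exact: bigcapT_measurable.
Qed.

End Link.

(** * Harmonicity, convergence in direction, and conclusion *)

Section Assembly.
Variables (R : realType) (d : nat).
Local Notation V := 'rV[int]_d.
Variables (mu : V -> R) (hmu : prob_mass mu).
Local Notation M := (drift mu 0).

(** Invariance under [K] is a sum over the whole lattice; [escape] vanishes outside the orthant, so
    the sum restricts to it. *)
Lemma escape_harmonic : killed_harmonic mu (escape mu).
Proof.
move=> x /orthantP xA.
have fE x' : mu (x' - x) * escape mu x' = (fun z => mu z * escape mu (x + z)) (x' - x).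
  by rewrite /= (addrC x) subrK.
split; last first.
  rewrite [RHS](escapeE hmu) /kstep xA mul1r /step -(lsum_shift _ x) lsum_mkcond.
  congr lsum; apply/funext => z; rewrite -fE.
  case: (boolP (inA z)) => zA; last by rewrite (escape_out hmu zA) !mulr0.
  by rewrite mem_set ?mul1r//; exact/orthantP.
apply: (@le_lt_trans _ _ (\esum_(z in [set: V]) (mu (z - x))%:E)).
  rewrite esum_mkcond; apply: le_esum => z _; case: ifP => _; last by rewrite lee_fin hmu.1.
  have /andP[h0 h1] := escape01 hmu z; rewrite lee_fin normrM !ger0_norm ?hmu.1//.
  by rewrite ler_piMr// hmu.1.
rewrite (@reindex_esum _ _ _ setT setT (fun v => v + x)); last first.
  split => //; first by move=> u v _ _ /addIr.
  by move=> v _; exists (v - x) => //; rewrite subrK.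
under eq_esum do rewrite addrK.
by rewrite hmu.2 ltry.
Qed.

(** The time is the integer part of [|u n| / |M|]. The error in the direction contributes at most
    [D / 4 * (t + 1)] and the rounding at most [B]. *)
Lemma direction_near (i0 : 'I_d) (u : nat -> V) (D : R) t0 : 0 < M i0 -> 0 < D ->
  enorm (intv R (u n)) @[n --> \oo] --> +oo ->
  (enorm (intv R (u n)))^-1 *: intv R (u n) @[n --> \oo]
       --> (enorm (drift mu))^-1 *: drift mu ->
  \forall n \near \oo, exists2 t, (t0 <= t)%N & nearM mu D t (u n).
Proof.
move=> M0 D0 hr hu; set q := enorm (drift mu) in hu.
have q0 : 0 < q.
  rewrite sqrtr_gt0 (bigD1 i0)//= ltr_wpDr ?exprn_gt0//.
  by apply: sumr_ge0 => i _; exact: sqr_ge0.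
have [B hB] : exists B : R, forall i, `|M i| <= B.
  exists (\sum_i `|M i|) => i; rewrite (bigD1 i)//= lerDl.
  by apply: sumr_ge0 => j _.
have B0 : 0 <= B by exact: le_trans (hB i0).
have e0 : 0 < D / (4 * q) by rewrite divr_gt0// mulr_gt0.
have hv : \forall n \near \oo, ball (q^-1 *: drift mu) (D / (4 * q))
    ((enorm (intv R (u n)))^-1 *: intv R (u n)) := cvg_ball hu e0.
(* The bound leaves [t >= t0 + 1 + 4 B / D] after rounding, so that [B] and [D / 4] are each at most
   [D t / 4]. *)
have hL : \forall n \near \oo, q * (t0%:R + 2 + 4 * B / D) <= enorm (intv R (u n)).
  by move/cvgryPge : hr; apply.
near=> n.
have rL : q * (t0%:R + 2 + 4 * B / D) <= enorm (intv R (u n)) by near: n.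
have hb : ball (q^-1 *: drift mu) (D / (4 * q))
    ((enorm (intv R (u n)))^-1 *: intv R (u n)) by near: n; exact: hv.
set r := enorm (intv R (u n)) in hb rL.
have BD : 0 <= 4 * B / D by rewrite divr_ge0 ?mulr_ge0// ltW.
have r0 : 0 < r by apply: lt_le_trans rL; rewrite mulr_gt0// -addrA ltr_wpDl// ltr_wpDr.
have rq : t0%:R + 2 + 4 * B / D <= r / q by rewrite ler_pdivlMr// mulrC.
have [t tE] : exists t, t = Num.truncn (r / q) by eexists.
have /andP[t1 t2] : t%:R <= r / q < t.+1%:R by rewrite tE truncn_itv//; apply: ltW; exact: divr_gt0.
rewrite -natr1 in t2.
exists t.
  have : (t0%:R : R) <= t%:R by lra.
  by rewrite ler_nat.
apply/forallP => i.
have vb : `|(q^-1 *: drift mu) 0 i - (r^-1 *: intv R (u n)) 0 i| < D / (4 * q).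
  by move: hb => [_ /(_ 0 i)]; rewrite -ball_normE.
have e1 : (q^-1 *: drift mu) 0 i = q^-1 * M i by rewrite mxE.
have e2 : (r^-1 *: intv R (u n)) 0 i = r^-1 * (u n 0 i)%:~R by rewrite 2!mxE.
rewrite e1 e2 in vb.
have h1 : `|(u n 0 i)%:~R - r / q * M i| <= r * (D / (4 * q)).
  have -> : (u n 0 i)%:~R - r / q * M i = r * (r^-1 * (u n 0 i)%:~R - q^-1 * M i).
    by field; rewrite !gt_eqF.
  by rewrite normrM gtr0_norm// ler_wpM2l ?(ltW r0)// distrC ltW.
have h2 : r * (D / (4 * q)) = D / 4 * (r / q) by field; rewrite gt_eqF.
have h3 : `|r / q * M i - t%:R * M i| <= B.
  rewrite -mulrBl normrM -[leRHS]mul1r; apply: ler_pM => //.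
  by rewrite ger0_norm; lra.
have h4 : 4 * B <= D * t%:R.
  have : 4 * B / D <= t%:R by have := ler0n R t0; lra.
  by rewrite ler_pdivrMr// [leRHS]mulrC.
have h5 : D / 4 * (r / q) <= D / 4 * (t%:R + 1).
  by rewrite ler_wpM2l ?divr_ge0 ?(ltW D0)// ltW.
have h6 : D <= D * t%:R by rewrite ler_peMr ?(ltW D0)//; have := ler0n R t0; lra.
have -> : (u n 0 i)%:~R - t%:R * M i =
  ((u n 0 i)%:~R - r / q * M i) + (r / q * M i - t%:R * M i) by rewrite addrA subrK.
apply: le_trans (ler_normD _ _) _; rewrite h2 in h1; lra.
Unshelve. all: by end_near. Qed.

End Assembly.

Lemma green_gkilled (R : realType) (d : nat) (mu : 'rV[int]_d -> R) (hmu : prob_mass mu)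
    (dO : measure_display) (Omega : measurableType dO)
    (P : 'rV[int]_d -> probability Omega R) (S : nat -> Omega -> 'rV[int]_d)
    (hS : random_walk mu P S) (a : 'rV[R]_d) (rho : R) x y :
  0 <= rho < 1 -> (laplace mu a <= rho%:E)%E -> inA y ->
  green P S x y = (gkilled mu y x)%:E.
Proof.
move=> rho01 ha yA; rewrite (greenE hmu hS)//; apply: cvg_lim => //.
rewrite (_ : (fun n => _) = fun n => (gkpart mu n y x)%:E); last first.
  by apply/funext => n; rewrite sumEFin.
apply: cvg_EFin; first exact: nearW.
exact: (gkpart_cvg hmu rho01 ha).
Qed.

Theorem corollary1p1 (R : realType) (d : nat) (hd : (1 <= d)%N)
    (mu : 'rV[int]_d -> R) (hmu : prob_mass mu)
    (dO : measure_display) (Omega : measurableType dO)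
    (P : 'rV[int]_d -> probability Omega R)
    (S : nat -> Omega -> 'rV[int]_d) (hS : random_walk mu P S)
    (x0 : 'rV[int]_d) (hx0 : orthant x0)
    (h_irr : forall L : {set 'I_d}, communicates mu (orthant_on L))
    (h_exp : set_nbhs (sublevel1 mu) [set a | (laplace mu a < +oo)%E])
    (h_drift : drift mu <> 0)
    (h_pos : forall i, 0 < drift mu 0 i) :
  ((forall x, orthant x -> 0 < survival P S x) /\ killed_harmonic mu (survival P S)) /\
  (forall u : nat -> 'rV[int]_d,
     (forall n, orthant (u n)) ->
     enorm (intv R (u n)) @[n --> \oo] --> +oo ->
     (enorm (intv R (u n)))^-1 *: intv R (u n) @[n --> \oo]
       --> (enorm (drift mu))^-1 *: drift mu ->
     fundamental P S x0 u /\
     (forall x, orthant x ->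
        (green P S x (u n) / green P S x0 (u n))%E @[n --> \oo]
          --> (survival P S x / survival P S x0)%:E)).
Proof.
have survE : survival P S = escape mu by apply/funext => x; exact: (survivalE hmu hS).
have [s [rho [s0 rho01 hs]]] := neg_params hmu h_exp h_pos.
pose i0 : 'I_d := Ordinal hd.
have ha := hs i0.
have h_irr0 := h_irr finset.set0; have h_irrT := h_irr finset.setT.
have hk0 x : orthant x -> 0 < escape mu x.
  by move=> /orthantP xA; exact: (escape_gt0 hmu h_exp h_pos h_irrT xA).
rewrite survE; split; first by split; [exact: hk0|exact: escape_harmonic].
move=> u uA ur ud.
suff lim x : orthant x -> (green P S x (u n) / green P S x0 (u n))%E @[n --> \oo]
    --> (escape mu x / escape mu x0)%:E.
  split; last exact: lim.
  by split => // x xA; exists (escape mu x / escape mu x0); exact: lim.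
move=> xA; pose g0 n := gfree mu (u n) 0.
have g00 n : 0 < g0 n.
  have [l l0 hl] := harnack_exp hmu h_irr0 rho01 ha.
  have [h _] := hl (u n) 0.
  have := lt_le_trans ltr01 (le_trans (gfree_diag hmu rho01 ha (u n)) h).
  by rewrite pmulr_rgt0// expR_gt0.
(* Both Green functions are normalised by [g0 n], which cancels in their quotient. *)
have ratio y : gkilled mu (u n) y / g0 n @[n --> \oo] --> escape mu y.
  apply/cvgrPdist_le => th th0.
  have [D [D0 [t0 ht0]]] := gkilled_limit hmu h_exp h_pos h_irr0 rho01 ha i0 y th0.
  have := direction_near t0 (h_pos i0) D0 ur ud.
  apply: filterS => n [t tt yD]; have /orthantP unA := uA n.
  have := ht0 t tt (u n) unA yD; rewrite -/(g0 n) => h.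
  have -> : escape mu y - gkilled mu (u n) y / g0 n = - ((gkilled mu (u n) y - g0 n * escape mu y) / g0 n).
    by field; rewrite gt_eqF.
  by rewrite normrN normrM normfV (gtr0_norm (g00 n)) ler_pdivrMr.
have x0pos := hk0 _ hx0.
(* The extended quotient agrees with real division only for a nonzero denominator; this holds
   eventually because [escape mu x0 > 0]. *)
have gx0 : \forall n \near \oo, gkilled mu (u n) x0 != 0.
  have : \forall n \near \oo, 0 < gkilled mu (u n) x0 / g0 n.
    by apply: (cvgr_gt (escape mu x0)); [exact: ratio|].
  apply: filterS => n; rewrite pmulr_lgt0 ?invr_gt0// => h.
  by rewrite gt_eqF.
have gE n y : green P S y (u n) = (gkilled mu (u n) y)%:E.
  by apply: (green_gkilled hmu hS y rho01 ha); exact/orthantP.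
have E : \forall n \near \oo, ((gkilled mu (u n) x / g0 n) / (gkilled mu (u n) x0 / g0 n))%:E =
    (green P S x (u n) / green P S x0 (u n))%E.
  apply: filterS gx0 => n hn; rewrite !gE inver (negPf hn) -EFinM; congr (_%:E).
  by field; rewrite hn gt_eqF.
apply: cvg_trans (near_eq_cvg E) _.
apply: cvg_EFin; first exact: nearW.
by apply: cvgM; [exact: ratio|apply: cvgV; [rewrite gt_eqF|exact: ratio]].
Qed.
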